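(* For any $\sigma\in S_n$ and $I\in\mathcal I_\lambda$ there is a unique element $[\widetilde W_{\sigma,I}]\in K_T(T^*\mathcal F_\lambda)$ such that $[\widetilde W_{\sigma,I}]|_{x_J}=\widetilde W_{\sigma,I}(z_J,z,h)$ for all $J\in\mathcal I_\lambda$. Moreover, $\kappa_{\sigma,I}:=[\widetilde W_{\sigma,I}]$ satisfies: (I) $\kappa_{\sigma,I}|_{x_J}$ is divisible by $e^{\mathrm{vert}}_{\sigma,J,-}$ for all $J$; (II) $\kappa_{\sigma,I}|_{x_I}=P_{\sigma,I}e_{\sigma,I}$; (III) $\kappa_{\sigma,I}|_{x_J}$ is $J$-small for all $J\ne I$.
   Context: Fix $N,n$, $\lambda\in\mathbb Z_{\ge0}^N$, $\sum\lambda_k=n$; $\lambda^{(k)}=\lambda_1+\dots+\lambda_k$, $\lambda^{\{1\}}=\sum_{k=1}^{N-1}\lambda^{(k)}$. $\mathcal I_\lambda$ = ordered partitions $I=(I_1,\dots,I_N)$ of $\{1,\dots,n\}$ with $|I_k|=\lambda_k$; $I_1\cup\dots\cup I_k=\{i^{(k)}_1<\dots<i^{(k)}_{\lambda^{(k)}}\}$; $\sigma(I)=(\sigma(I_1),\dots,\sigma(I_N))$. $K_T(T^*\mathcal F_\lambda)=\mathbb C[\Gamma^{\pm1}]^{S_\lambda}\otimes\mathbb C[z^{\pm1},h^{\pm1}]/\langle f(\Gamma)=f(z),\ f\in\mathbb C[z^{\pm1}]^{S_n}\rangle$, $\Gamma=(\gamma_{k,a})_{k\le N,a\le\lambda_k}$,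 $S_\lambda=\prod S_{\lambda_k}$ permuting variables with the same first index. Restriction $[f]|_{x_J}$: substitution $\{\gamma_{k,1},\dots,\gamma_{k,\lambda_k}\}\mapsto\{z_a:a\in J_k\}$. Weight functions: variables $t^{(k)}_a$ ($1\le k\le N-1$), $t^{(N)}_a=z_a$; $U_I=\prod_{k=1}^{N-1}\prod_{a=1}^{\lambda^{(k)}}\Big(\prod_{c:\,i^{(k+1)}_c<i^{(k)}_a}(1-ht^{(k+1)}_c/t^{(k)}_a)\prod_{c:\,i^{(k+1)}_c>i^{(k)}_a}(1-t^{(k+1)}_c/t^{(k)}_a)\prod_{b=a+1}^{\lambda^{(k)}}\frac{1-ht^{(k)}_b/t^{(k)}_a}{1-t^{(k)}_b/t^{(k)}_a}\Big)$ ($c\in\{1..\lambda^{(k+1)}\}$); $W_I=(1-h)^{\lambda^{\{1\}}}\mathrm{Sym}_{t^{(1)}}\cdots\mathrm{Sym}_{t^{(N-1)}}U_I$; $W_{\sigma,I}(t,z,h)=W_{\sigma^{-1}(I)}(t,z_{\sigma(1)},\dots,z_{\sigma(n)},h)$; $E(t,h)=\prod_{k=1}^{N-1}\prod_{a,b}(1-ht^{(k)}_b/t^{(k)}_a)$; $\widetilde W_{\sigma,I}=W_{\sigma,I}/E$; $f(z_J,z,h)$ = substitution $t^{(k)}_a=z_{j^{(k)}_a}$ with $J_1\cup\dots\cup J_k=\{j^{(k)}_1<\dots\}$. $P_{\sigma,I}=\prod_{k<l}\prod_{\sigma(a)\in I_k}\prod_{\sigma(b)\in I_l,b>a}(-z_{\sigma(b)}/z_{\sigma(a)})$;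 $e^{\mathrm{vert}}_{\sigma,I,-}=\prod_{k<l}\prod_{\sigma(a)\in I_k}\prod_{\sigma(b)\in I_l,b<a}(1-hz_{\sigma(b)}/z_{\sigma(a)})$; $e_{\sigma,I}=e^{\mathrm{vert}}_{\sigma,I,-}\prod_{k<l}\prod_{\sigma(a)\in I_k}\prod_{\sigma(b)\in I_l,b>a}(1-z_{\sigma(a)}/z_{\sigma(b)})$. $J$-small: with $N(f)$ the Newton polytope in $z$ (coefficients in $\mathbb C[h^{\pm1}]$) and $\phi_J(\epsilon_a)=k$ for $a\in J_k$, $\phi_J(N(f))\subset[0,\sum_{k<l}\lambda_k\lambda_l(l-k)-1]$. *)

(* Defs.v *)
From HB Require Import structures.
From mathcomp Require Import all_boot all_order all_algebra all_fingroup.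
From Stdlib Require List.
Set Implicit Arguments. Unset Strict Implicit. Unset Printing Implicit Defensive.
Import Order.TTheory GRing.Theory Num.Theory.
Local Open Scope ring_scope.

Section Defs.
Variable F : numClosedFieldType.
Variables N n : nat.
Variable lam : 'I_N -> nat.        (* lambda, 0-based blocks k = 0..N-1 *)

(* ---------- Laurent polynomials, viewed as functions on the torus ---------- *)
Definition torus (x : 'I_n -> F) := forall i, x i != 0.
Definition mon (e : 'I_n -> int) (x : 'I_n -> F) : F := \prod_i x i ^ e i.

Definition laurent_z (f : ('I_n -> F) -> F) :=
  exists L : seq (F * ('I_n -> int)),
    forall z, torus z -> f z = \sum_(t <- L) t.1 * mon t.2 z.

Definition laurent_zh (f : ('I_n -> F) -> F -> F) :=
  exists L : seq (F * ('I_n -> int) * int),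
    forall z h, torus z -> h != 0 ->
      f z h = \sum_(t <- L) t.1.1 * mon t.1.2 z * h ^ t.2.

(* Laurent polynomials in (Gamma, z, h); Gamma flattened: gamma_{k,a} is index
   Lpre k + a (0-based) *)
Definition laurent_Gzh (p : ('I_n -> F) -> ('I_n -> F) -> F -> F) :=
  exists L : seq (F * ('I_n -> int) * ('I_n -> int) * int),
    forall g z h, torus g -> torus z -> h != 0 ->
      p g z h = \sum_(t <- L) t.1.1.1 * mon t.1.1.2 g * mon t.1.2 z * h ^ t.2.

(* lambda^(k+1) in the paper's 1-based notation = Lsum k here *)
Definition Lsum (k : nat) : nat := (\sum_(j < N | j <= k) lam j)%N.
Definition Lpre (k : nat) : nat := (\sum_(j < N | j < k) lam j)%N.
(* block (0-based) and position of the flattened Gamma index i *)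
Definition gblk (i : nat) : nat := #|[pred k : 'I_N | (Lsum k <= i)%N]|.
Definition gpos (i : nat) : nat := (i - Lpre (gblk i))%N.

Definition KTinv (p : ('I_n -> F) -> ('I_n -> F) -> F -> F) :=
  forall s : 'S_n, (forall i, gblk (s i) = gblk i) ->
    forall g z h, torus g -> torus z -> h != 0 ->
      p (fun i => g (s i)) z h = p g z h.

(* elements of C[Gamma^{+-1}]^{S_lambda} (x) C[z^{+-1},h^{+-1}] *)
Definition KT p := laurent_Gzh p /\ KTinv p.

Definition sym_z (f : ('I_n -> F) -> F) :=
  forall s : 'S_n, forall z, torus z -> f (fun i => z (s i)) = f z.

Definition in_ideal (p : ('I_n -> F) -> ('I_n -> F) -> F -> F) :=
  exists L : seq ((('I_n -> F) -> ('I_n -> F) -> F -> F) * (('I_n -> F) -> F)),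
    (forall c f, List.In (c, f) L -> [/\ KT c, laurent_z f & sym_z f]) /\
    forall g z h, torus g -> torus z -> h != 0 ->
      p g z h = \sum_(t <- L) t.1 g z h * (t.2 g - t.2 z).

(* ordered partitions I in I_lambda, encoded by the block map x |-> k, x in I_k *)
Definition is_part (I : {ffun 'I_n -> 'I_N}) :=
  forall k : 'I_N, #|[pred x | I x == k]| = lam k.

(* restriction [f]|_{x_J}: {gamma_{k,.}} |-> {z_a : a in J_k} *)
Definition Gam (J : {ffun 'I_n -> 'I_N}) (z : 'I_n -> F) : 'I_n -> F :=
  fun i => nth 0 [seq z x | x <- enum 'I_n & nat_of_ord (J x) == gblk i] (gpos i).
Definition restr (p : ('I_n -> F) -> ('I_n -> F) -> F -> F)
  (J : {ffun 'I_n -> 'I_N}) : ('I_n -> F) -> F -> F :=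
  fun z h => p (Gam J z) z h.

(* i^{(k+1)}_{a+1} (paper) = iota B k a here: a-th smallest element of
   B^{-1}({0..k}) *)
Definition ords (B : 'I_n -> 'I_N) (k : nat) : seq nat :=
  [seq nat_of_ord x | x <- enum 'I_n & (B x <= k)%N].
Definition iota_ (B : 'I_n -> 'I_N) (k a : nat) : nat := nth 0%N (ords B k) a.

(* t k a = t^{(k+1)}_{a+1}; level k = N-1 is the z-level *)
Definition Uval (B : 'I_n -> 'I_N) (t : nat -> nat -> F) (h : F) : F :=
  \prod_(k < N.-1) \prod_(a < Lsum k)
    ((\prod_(c < Lsum k.+1 | (iota_ B k.+1 c < iota_ B k a)%N)
         (1 - h * t k.+1 c / t k a)) *
     (\prod_(c < Lsum k.+1 | (iota_ B k a < iota_ B k.+1 c)%N)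
         (1 - t k.+1 c / t k a)) *
     (\prod_(a.+1 <= b < Lsum k)
         ((1 - h * t k b / t k a) / (1 - t k b / t k a)))).

Definition permn (s : 'S_n) (a : nat) : nat :=
  match (insub a : option 'I_n) with Some i => nat_of_ord (s i) | None => a end.
Definition permt (s : {ffun 'I_N -> {perm 'I_n}}) (t : nat -> nat -> F) :=
  fun k a => match (insub k : option 'I_N) with
             | Some k' => t k (permn (s k') a) | None => t k a end.
(* s k ranges over the permutations of {0..lambda^(k+1)-1} for k < N-1,
   and is trivial for k = N-1: this realises Sym_{t^(1)} ... Sym_{t^(N-1)} *)
Definition adm (s : {ffun 'I_N -> {perm 'I_n}}) : bool :=
  [forall k : 'I_N, forall i : 'I_n,
     (s k i != i) ==> ((i < Lsum k)%N && (k < N.-1)%N)].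

Definition lam1 : nat := (\sum_(k < N.-1) Lsum k)%N.

Definition Wfun (B : 'I_n -> 'I_N) (t : nat -> nat -> F) (h : F) : F :=
  (1 - h) ^+ lam1 * \sum_(s : {ffun 'I_N -> {perm 'I_n}} | adm s) Uval B (permt s t) h.

Definition Eval (t : nat -> nat -> F) (h : F) : F :=
  \prod_(k < N.-1) \prod_(a < Lsum k) \prod_(b < Lsum k) (1 - h * t k b / t k a).

(* the substitution t^{(k)}_a = z_{j^{(k)}_a} (k < N) together with
   t^{(N)}_a = z_{sigma(a)} (from W_{sigma,I} = W_{sigma^{-1}(I)}(t, z_sigma, h)) *)
Definition tJ (sigma : 'S_n) (J : {ffun 'I_n -> 'I_N}) (z : 'I_n -> F) :=
  fun k a => if (k < N.-1)%N
             then nth 0 [seq z x | x <- enum 'I_n & (J x <= k)%N] a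
             else nth 0 [seq z (sigma x) | x <- enum 'I_n] a.

Definition Wt (sigma : 'S_n) (I J : {ffun 'I_n -> 'I_N}) (z : 'I_n -> F) (h : F) : F :=
  Wfun (fun x => I (sigma x)) (tJ sigma J z) h / Eval (tJ sigma J z) h.

(* generic points: all denominators above are nonzero *)
Definition generic (z : 'I_n -> F) (h : F) :=
  [/\ torus z, injective z, h != 0, h != 1 & forall a b, z a != h * z b].

Definition Pf (sigma : 'S_n) (I : {ffun 'I_n -> 'I_N}) (z : 'I_n -> F) (h : F) : F :=
  \prod_(a : 'I_n) \prod_(b : 'I_n | (I (sigma a) < I (sigma b))%N && (a < b)%N)
     (- (z (sigma b) / z (sigma a))).
Definition evert (sigma : 'S_n) (I : {ffun 'I_n -> 'I_N}) (z : 'I_n -> F) (h : F) : F :=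
  \prod_(a : 'I_n) \prod_(b : 'I_n | (I (sigma a) < I (sigma b))%N && (b < a)%N)
     (1 - h * z (sigma b) / z (sigma a)).
Definition ef (sigma : 'S_n) (I : {ffun 'I_n -> 'I_N}) (z : 'I_n -> F) (h : F) : F :=
  evert sigma I z h *
  \prod_(a : 'I_n) \prod_(b : 'I_n | (I (sigma a) < I (sigma b))%N && (a < b)%N)
     (1 - z (sigma a) / z (sigma b)).

Definition phiJ (J : {ffun 'I_n -> 'I_N}) (e : 'I_n -> int) : int :=
  \sum_(a : 'I_n) ((J a).+1)%:Z * e a.
Definition Mbound : int :=
  \sum_(k < N) \sum_(l < N | (k < l)%N) (lam k * lam l * (l - k))%:Z.
(* the Newton polytope in z (coefficients in C[h^{+-1}]) maps into
   [0, Mbound - 1] under phi_J; equivalently all monomials of some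
   (equivalently, the reduced) representation do *)
Definition small (J : {ffun 'I_n -> 'I_N}) (f : ('I_n -> F) -> F -> F) :=
  exists L : seq (F * ('I_n -> int) * int),
    (forall z h, torus z -> h != 0 ->
       f z h = \sum_(t <- L) t.1.1 * mon t.1.2 z * h ^ t.2) /\
    (forall t, List.In t L -> t.1.1 != 0 ->
       (0 <= phiJ J t.1.2) && (phiJ J t.1.2 <= Mbound - 1)).

End Defs.

(* Main.v *)
Require Import Defs.
From HB Require Import structures.
From mathcomp Require Import all_boot all_order all_algebra all_fingroup.
From mathcomp Require Import zify ring.
From Stdlib Require Import FunctionalExtensionality IndefiniteDescription.
Import Order.TTheory GRing.Theory Num.Theory.
Local Open Scope ring_scope.

(* Fix [J] and write [J^k] for the set of [x] in [J_1, ..., J_k].  A term of the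
   symmetrisation defining [W_(sigma,I)(z_J)] is a choice of bijections [Q_k] from
   [J^k] to the corresponding union of blocks of [sigma^-1 I], with [Q_N = sigma^-1].
   - A factor [1 - z_x / z_x] kills the term unless [Q_(k+1) x <= Q_k x] always.  In
     the surviving terms the factors of [E] cancel against the numerator one by one,
     and those of [e^vert_J] remain: so [W~(z_J)] times a Vandermonde product, in
     which [h] does not occur, is divisible by [e^vert_J].  As [W] itself is a Laurent
     polynomial in independent [t] (an alternant divided by Vandermonde factors) and
     the primes [1 - h z_y / z_x] do not divide the Vandermonde product, [W~(z_J)] is
     a Laurent polynomial divisible by [e^vert_J].
   - For [J = I] the inequalities force [Q_k = sigma^-1], and one term is left.
   - Smallness is a degree count along [z_x |-> q^k z_x] for [x] in [J_k].
   - [W(z_J)] depends on [z_J] through the multisets of values of the [t^(k)], hence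
     the restrictions at [J] and at [J] with [a, b] exchanged agree when [z_a = z_b].
     Lagrange interpolation over the [S_n]-orbit of [z] with kernel
     [prod_(i<j) (z_j - g_i)] turns such a family into a class, and the same kernel
     shows that a class with vanishing restrictions lies in the ideal. *)

Set Implicit Arguments. Unset Strict Implicit. Unset Printing Implicit Defensive.

(** * Laurent polynomial functions on a torus *)

(** [W~] is a priori only a rational function of [t], so no substitution of [Gamma] for [t] yields
    the class; only the restrictions turn out to be Laurent, and the class is rebuilt from them. Two
    kinds of denominators have to go. The factors [1 - t_b / t_a] are removed in independent [t],
    which gives one [G] for all [J]; comparing fixed points rests on this uniformity. [E] can be
    removed only after the substitution, because its cancellation uses the vanishing of terms; but
    there single terms have the denominators [1 - z_y / z_x] again, hence the multiplication by
    [Vred]. It does no harm since the zero locus of [1 - h z_y / z_x] lies over every [z]. Laurent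
    polynomials are functions compared off the zero set of another one, so points where the division
    in [Wt] is meaningless can be ignored. The [- 1] in smallness comes from an omitted factor: each
    [x] at level [k] has a partner at level [k + 1] that gives no factor, and for [J != I] some
    partner lies in a later block of [J] than its [x]. *)

Section Laurent.
Variable F : numClosedFieldType.

Section OneType.
Variable V : finType.
Implicit Types (f g p : (V -> F) -> F) (x y : V -> F).

Definition tor x := forall v, x v != 0.
Definition mono (e : V -> int) x : F := \prod_v x v ^ e v.
Definition laur f :=
  exists L : seq (F * (V -> int)),
    forall x, tor x -> f x = \sum_(t <- L) t.1 * mono t.2 x.

Lemma laur_eq f g : laur f -> (forall x, tor x -> g x = f x) -> laur g.
Proof. by move=> [L HL] E; exists L => x hx; rewrite E // HL. Qed.

Lemma mono_neq0 e x : tor x -> mono e x != 0.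
Proof. by move=> hx; apply/prodf_neq0 => v _; rewrite expfz_neq0. Qed.

Lemma monoD e e' x : tor x -> mono (fun v => e v + e' v) x = mono e x * mono e' x.
Proof. by move=> hx; rewrite -big_split; apply: eq_bigr => v _; rewrite /= expfzDr. Qed.

Lemma monoN e x : mono (fun v => - e v) x = (mono e x)^-1.
Proof. by rewrite /mono -prodfV; apply: eq_bigr => v _; rewrite invr_expz. Qed.

Lemma laur_mono e : laur (mono e).
Proof. by exists [:: (1, e)] => x _; rewrite big_seq1 mul1r. Qed.

Lemma laur_cst c : laur (fun=> c).
Proof.
exists [:: (c, fun=> 0)] => x _; rewrite big_seq1 /mono big1 ?mulr1 //.
Qed.

Lemma laur_add f g : laur f -> laur g -> laur (fun x => f x + g x).
Proof.
by move=> [L HL] [M HM]; exists (L ++ M) => x hx; rewrite big_cat /= HL // HM.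
Qed.

Lemma laur_mul f g : laur f -> laur g -> laur (fun x => f x * g x).
Proof.
move=> [L HL] [M HM].
exists [seq (t.1 * u.1, fun v => t.2 v + u.2 v) | t <- L, u <- M] => x hx.
rewrite big_allpairs_dep /= HL // HM // mulr_suml; apply: eq_bigr => t _.
rewrite mulr_sumr; apply: eq_bigr => u _; rewrite monoD //; ring.
Qed.

Lemma laur_opp f : laur f -> laur (fun x => - f x).
Proof.
move=> hf; apply: (laur_eq (laur_mul (laur_cst (-1)) hf)) => x _.
by rewrite mulN1r.
Qed.

Lemma laur_sub f g : laur f -> laur g -> laur (fun x => f x - g x).
Proof. by move=> hf hg; exact: (laur_add hf (laur_opp hg)). Qed.

Lemma laur_sum (I : Type) (r : seq I) (P : pred I) (G : I -> (V -> F) -> F) :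
  (forall i, P i -> laur (G i)) -> laur (fun x => \sum_(i <- r | P i) G i x).
Proof.
move=> hG; elim: r => [|i r IH].
  by apply: (laur_eq (laur_cst 0)) => x _; rewrite big_nil.
case Pi: (P i).
  by apply: (laur_eq (laur_add (hG i Pi) IH)) => x _; rewrite big_cons Pi.
by apply: (laur_eq IH) => x _; rewrite big_cons Pi.
Qed.

Lemma laur_prod (I : Type) (r : seq I) (P : pred I) (G : I -> (V -> F) -> F) :
  (forall i, P i -> laur (G i)) -> laur (fun x => \prod_(i <- r | P i) G i x).
Proof.
move=> hG; elim: r => [|i r IH].
  by apply: (laur_eq (laur_cst 1)) => x _; rewrite big_nil.
case Pi: (P i).
  by apply: (laur_eq (laur_mul (hG i Pi) IH)) => x _; rewrite big_cons Pi.
by apply: (laur_eq IH) => x _; rewrite big_cons Pi.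
Qed.

Lemma laur_exp f n : laur f -> laur (fun x => f x ^+ n).
Proof.
move=> hf; elim: n => [|n IH]; first exact: (laur_eq (laur_cst 1)).
by apply: (laur_eq (laur_mul hf IH)) => x _; rewrite exprS.
Qed.

(** Units of the Laurent ring. Only units may replace a variable, since its exponents may be
    negative. *)
Definition ulaur f :=
  [/\ laur f, laur (fun x => (f x)^-1) & forall x, tor x -> f x != 0].

Lemma mono1E v j x : mono (fun u => if u == v then j else 0) x = x v ^ j.
Proof.
rewrite /mono (bigD1 v) //= eqxx big1 ?mulr1 // => u /negbTE ->.
by rewrite expr0z.
Qed.

Lemma ulaur_mono e : ulaur (mono e).
Proof.
split; [exact: laur_mono | | exact: mono_neq0].
by apply: (laur_eq (laur_mono (fun v => - e v))) => x _; rewrite monoN.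
Qed.

Lemma ulaur_var v : ulaur (fun x => x v).
Proof.
have [h1 h2 h3] := ulaur_mono (fun u => if u == v then 1 else 0).
split; last by move=> x; apply.
  by apply: (laur_eq h1) => x _; rewrite mono1E expr1z.
by apply: (laur_eq h2) => x _; rewrite mono1E expr1z.
Qed.

Lemma laur_var v : laur (fun x => x v).
Proof. by case: (ulaur_var v). Qed.

Lemma ulaur_inv f : ulaur f -> ulaur (fun x => (f x)^-1).
Proof.
case=> h1 h2 h3; split=> // [|x hx]; last by rewrite invr_eq0 h3.
by apply: (laur_eq h1) => x _; rewrite invrK.
Qed.

Lemma ulaur_mul f g : ulaur f -> ulaur g -> ulaur (fun x => f x * g x).
Proof.
case=> h1 h2 h3 [k1 k2 k3]; split=> [||x hx]; first exact: laur_mul.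
  by apply: (laur_eq (laur_mul h2 k2)) => x _; rewrite invfM.
by rewrite mulf_neq0 ?h3 ?k3.
Qed.

Lemma laur_expz f (j : int) : ulaur f -> laur (fun x => f x ^ j).
Proof.
case=> h1 h2 _; case: j => n; first exact: laur_exp.
by apply: (laur_eq (laur_exp n.+1 h2)) => x _; rewrite /= exprVn.
Qed.

(* Along a line in the ambient affine space, a Laurent polynomial becomes a
   polynomial after clearing the powers of the coordinates. *)
Definition line x y (q : F) : V -> F := fun v => x v + q * (y v - x v).

Lemma laur_line f x y : laur f ->
  exists (P : {poly F}) (K : nat), forall q, tor (line x y q) ->
    f (line x y q) * (\prod_v line x y q v) ^+ K = P.[q].
Proof.
case=> L; elim: L f => [|t L IH] f HL.
  by exists 0, 0%N => q hq; rewrite HL // big_nil mul0r horner0.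
have [P [K HP]] := IH (fun x => \sum_(t <- L) t.1 * mono t.2 x) (fun _ _ => erefl).
pose lin v : {poly F} := (x v)%:P + 'X * (y v - x v)%:P.
have linE q v : (lin v).[q] = line x y q v by rewrite /lin !hornerE.
pose M := (\sum_v `|t.2 v|)%N.
have hM v : 0 <= t.2 v + M%:Z.
  have : (`|t.2 v| <= M)%N by rewrite /M (bigD1 v) //= leq_addr.
  lia.
exists (t.1%:P * (\prod_v lin v ^+ absz (t.2 v + M%:Z)) * (\prod_v lin v) ^+ K
       + P * (\prod_v lin v) ^+ M), (M + K)%N => q hq.
have h1 : (\prod_v lin v).[q] = \prod_v line x y q v.
  by rewrite horner_prod; apply: eq_bigr => v _; rewrite linE.
have h2 : (\prod_v lin v ^+ absz (t.2 v + M%:Z)).[q]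
        = mono t.2 (line x y q) * (\prod_v line x y q v) ^+ M.
  rewrite horner_prod -prodrXl -big_split; apply: eq_bigr => v _ /=.
  by rewrite horner_exp linE !exprnP gez0_abs // expfzDr.
rewrite hornerD !hornerM hornerC [(_ ^+ K).[_]]horner_exp [(_ ^+ M).[_]]horner_exp h1 h2.
rewrite HL // big_cons -HP // exprD; ring.
Qed.

Lemma nonroot (P : {poly F}) : P != 0 -> exists q, P.[q] != 0.
Proof.
move=> nzP; pose s := [seq i%:R : F | i <- iota 0 (size P)].
have us : uniq s.
  by rewrite map_inj_uniq ?iota_uniq // => i j /eqP; rewrite eqr_nat => /eqP.
case E: (all (root P) s).
  have := max_poly_roots nzP E us; by rewrite size_map size_iota ltnn.
have /allPn[q _ hq] : ~~ all (root P) s by rewrite E.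
by exists q.
Qed.

(** The Laurent ring is a domain: on the line through [x] and [y], the cleared [f], the cleared [p]
    and the product of the coordinates are nonzero polynomials in [q], so some [q] is a root of none
    of them. *)
Lemma laur_common f p x y : laur f -> laur p -> tor x -> f x != 0 ->
  tor y -> p y != 0 -> exists2 t, tor t & f t * p t != 0.
Proof.
move=> lf lp hx fx hy py.
have [P [K HP]] := laur_line x y lf.
have [Q [M HQ]] := laur_line x y lp.
have l0 : line x y 0 = x by apply: functional_extensionality => v; rewrite /line mul0r addr0.
have l1 : line x y 1 = y by apply: functional_extensionality => v; rewrite /line mul1r addrC subrK.
pose lin v : {poly F} := (x v)%:P + 'X * (y v - x v)%:P.
have linE q v : (lin v).[q] = line x y q v by rewrite /lin !hornerE.
have P0 : P != 0.
  apply/eqP => P0; have := HP 0; rewrite l0 => /(_ hx) /eqP; rewrite P0 horner0.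
  by rewrite mulf_eq0 (negbTE fx) expf_eq0 prodf_seq_eq0 /=;
     case/andP=> _ /hasP[v _ /=]; rewrite (negbTE (hx v)).
have Q0 : Q != 0.
  apply/eqP => Q0; have := HQ 1; rewrite l1 => /(_ hy) /eqP; rewrite Q0 horner0.
  by rewrite mulf_eq0 (negbTE py) expf_eq0 prodf_seq_eq0 /=;
     case/andP=> _ /hasP[v _ /=]; rewrite (negbTE (hy v)).
have L0 : \prod_v lin v != 0.
  apply/prodf_neq0 => v _; apply/eqP => E.
  by have := linE 0 v; rewrite E horner0 l0 => /esym/eqP; rewrite (negbTE (hx v)).
have [q] := nonroot (mulf_neq0 (mulf_neq0 P0 Q0) L0).
rewrite !hornerM !mulf_eq0 !negb_or => /andP[/andP[Pq Qq]].
rewrite horner_prod => /prodf_neq0 Lq.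
have tq : tor (line x y q) by move=> v; rewrite -linE Lq.
move: Pq Qq; rewrite -HP // -HQ // !mulf_eq0 !negb_or => /andP[f0 _] /andP[p0 _].
by exists (line x y q) => //; rewrite mulf_neq0.
Qed.

(** Density; this lifts later identities from distinct or generic points to the whole torus. *)
Lemma laur_dom f p : laur f -> laur p -> (exists2 x, tor x & p x != 0) ->
  (forall x, tor x -> p x != 0 -> f x = 0) -> forall x, tor x -> f x = 0.
Proof.
move=> lf lp [y hy py] H x hx; apply/eqP/negPn/negP => fx.
have [t ht] := laur_common lf lp hx fx hy py.
by rewrite mulf_eq0 negb_or => /andP[ft pt]; rewrite H ?eqxx in ft.
Qed.

Lemma laur_domE f g p : laur f -> laur g -> laur p -> (exists2 x, tor x & p x != 0) ->
  (forall x, tor x -> p x != 0 -> f x = g x) -> forall x, tor x -> f x = g x.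
Proof.
move=> lf lg lp ep H x hx; apply/eqP; rewrite -subr_eq0; apply/eqP.
apply: (laur_dom (laur_sub lf lg) lp ep) => // y hy py.
by rewrite H ?subrr.
Qed.

Definition nzl f := laur f /\ exists2 x, tor x & f x != 0.

Lemma nzl_mul f g : nzl f -> nzl g -> nzl (fun x => f x * g x).
Proof.
move=> [lf [x hx fx]] [lg [y hy gy]]; split; first exact: laur_mul.
exact: (laur_common lf lg hx fx hy gy).
Qed.

Lemma nzl_prod (I : Type) (r : seq I) (P : pred I) (G : I -> (V -> F) -> F) :
  (forall i, P i -> nzl (G i)) -> nzl (fun x => \prod_(i <- r | P i) G i x).
Proof.
move=> hG; split; first by apply: laur_prod => i /hG[].
elim: r => [|i r [y hy py]].
  by exists (fun=> 1) => [v|]; rewrite ?big_nil oner_neq0.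
case Pi: (P i); last by exists y => //; rewrite big_cons Pi.
have [lG [x hx Gx]] := hG i Pi.
have lr : laur (fun x => \prod_(i <- r | P i) G i x) by apply: laur_prod => j /hG[].
have [t ht pt] := laur_common lG lr hx Gx hy py.
by exists t => //; rewrite big_cons Pi.
Qed.

Definition upd x v c : V -> F := fun u => if u == v then c else x u.

Lemma upd_id x v : upd x v (x v) = x.
Proof. by apply: functional_extensionality => u; rewrite /upd; case: eqP => [->|]. Qed.

Lemma tor_upd x v c : tor x -> c != 0 -> tor (upd x v c).
Proof. by move=> hx hc u; rewrite /upd; case: ifP. Qed.

Lemma laur_subX (a b : (V -> F) -> F) (j : int) : ulaur a -> ulaur b ->
  exists2 g, laur g & forall x, tor x -> a x ^ j - b x ^ j = (a x - b x) * g x.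
Proof.
move=> ua ub; have [la la' a0] := ua; have [lb lb' b0] := ub.
have pos n : exists2 g, laur g & forall x, tor x -> a x ^+ n - b x ^+ n = (a x - b x) * g x.
  elim: n => [|n [g lg Hg]].
    by exists (fun=> 0); [exact: laur_cst | move=> x _; rewrite !expr0 subrr mulr0].
  exists (fun x => a x * g x + b x ^+ n).
    by apply: laur_add; [exact: laur_mul | exact: laur_exp].
  move=> x hx; have := Hg x hx; rewrite !exprS => E.
  have -> : a x * a x ^+ n - b x * b x ^+ n = a x * (a x ^+ n - b x ^+ n) + (a x - b x) * b x ^+ n by ring.
  by rewrite E; ring.
case: j => n; first exact: pos.
have [g lg Hg] := pos n.+1.
exists (fun x => - (g x * (a x)^-1 ^+ n.+1 * (b x)^-1 ^+ n.+1)).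
  by apply: laur_opp; apply: laur_mul; [apply: laur_mul => //|]; exact: laur_exp.
move=> x hx; rewrite NegzE -!exprnN mulrN !mulrA -Hg // !exprVn.
have := expf_neq0 n.+1 (a0 x hx); have := expf_neq0 n.+1 (b0 x hx).
move: (a x ^+ n.+1) (b x ^+ n.+1) => A B B0 A0.
by field; rewrite A0 B0.
Qed.

(** Remainder theorem in the variable [v]; [m] is a unit because it takes the place of [x v] under
    negative exponents. *)
Lemma laur_sub_upd f v (m : (V -> F) -> F) : laur f -> ulaur m ->
  exists2 g, laur g &
    forall x, tor x -> f x - f (upd x v (m x)) = (x v - m x) * g x.
Proof.
move=> [L HL] um; have m0 x : tor x -> m x != 0 by case: um => _ _; apply.
have mon e : exists2 g, laur g &
    forall x, tor x -> mono e x - mono e (upd x v (m x)) = (x v - m x) * g x.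
  have [g lg Hg] := laur_subX (e v) (ulaur_var v) um.
  exists (fun x => g x * \prod_(u | u != v) x u ^ e u).
    apply: laur_mul => //; apply: laur_prod => u _; apply: laur_expz; exact: ulaur_var.
  move=> x hx; rewrite /mono (bigD1 v) //= [X in _ - X](bigD1 v) //=.
  have -> : \prod_(i | i != v) upd x v (m x) i ^ e i = \prod_(i | i != v) x i ^ e i.
    by apply: eq_bigr => u /negbTE hu; rewrite /upd hu.
  by rewrite {1}/upd eqxx -mulrBl Hg // mulrA.
suff [g lg Hg] : exists2 g, laur g & forall x, tor x ->
    \sum_(t <- L) t.1 * mono t.2 x - \sum_(t <- L) t.1 * mono t.2 (upd x v (m x))
    = (x v - m x) * g x.
  exists g => // x hx; rewrite HL // HL ?Hg //; apply: tor_upd => //; exact: m0.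
elim: L {HL} => [|t L [g lg Hg]].
  by exists (fun=> 0); [exact: laur_cst | move=> x _; rewrite !big_nil subrr mulr0].
have [g' lg' Hg'] := mon t.2.
exists (fun x => t.1 * g' x + g x).
  by apply: laur_add => //; apply: laur_mul => //; exact: laur_cst.
move=> x hx; rewrite !big_cons opprD addrACA Hg // -mulrBr Hg' //; ring.
Qed.
End OneType.

Lemma laur_subst (V V' : finType) (f : (V -> F) -> F) (g : V -> (V' -> F) -> F) :
  laur f -> (forall v, ulaur (g v)) -> laur (fun x => f (fun v => g v x)).
Proof.
move=> [L HL] ug.
have: laur (fun x => \sum_(t <- L) t.1 * mono t.2 (fun v => g v x)).
  apply: laur_sum => t _; apply: laur_mul; first exact: laur_cst.
  apply: laur_prod => v _; exact: laur_expz.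
move/laur_eq; apply=> x hx; rewrite HL // => v.
by case: (ug v) => _ _; apply.
Qed.

(** * Division by linear factors *)

Section Division.
Variable V : finType.
Implicit Types (f g p : (V -> F) -> F) (x y : V -> F).

(* [x v - m x] is a prime of the Laurent ring: its zero locus is the graph of
   [m], so divisibility is tested there. *)
Lemma laur_div f p v (m : (V -> F) -> F) : laur f -> laur p -> ulaur m ->
  (forall x c, m (upd x v c) = m x) ->
  (exists2 x, tor x & x v = m x /\ p x != 0) ->
  (forall x, tor x -> x v = m x -> f x * p x = 0) ->
  exists2 g, laur g & forall x, tor x -> f x = (x v - m x) * g x.
Proof.
move=> lf lp um mv [y hy [yv py]] H.
have m0 x : tor x -> m x != 0 by case: um => _ _; apply.
have [g lg Hg] := laur_sub_upd v lf um.
have subs q : laur q -> laur (fun x => q (upd x v (m x))).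
  move=> lq; apply: (laur_subst (g := fun u x => if u == v then m x else x u) lq) => u.
  case: (u == v) => //; exact: ulaur_var.
exists g => // x hx; rewrite -Hg //.
(* The remainder lives on the graph of [m], where [f * p = 0]. As [y] lies on the graph, [p] is not
   the zero function there and cancels by density. *)
suff -> : f (upd x v (m x)) = 0 by rewrite subr0.
apply: (laur_dom (f := fun x => f (upd x v (m x))) (subs f lf) (subs p lp)) => //.
  by exists y => //; rewrite -yv upd_id.
move=> {hx}x hx px; have tx : tor (upd x v (m x)) by apply: tor_upd => //; exact: m0.
have := H _ tx; rewrite mv {1}/upd eqxx => /(_ erefl)/eqP.
by rewrite mulf_eq0 (negbTE px) orbF => /eqP.
Qed.

Lemma nzl_sub_vars (a b : V) : a != b -> nzl (fun x => x b - x a).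
Proof.
move=> ab; split; first by apply: laur_sub; exact: laur_var.
exists (fun u => if u == b then 2 else 1) => [u|]; first by case: ifP; rewrite ?pnatr_eq0 ?oner_eq0.
rewrite eqxx (negbTE ab) subr_eq0; apply/eqP => E.
by move/eqP: E; rewrite -[1]/(1%:R) eqr_nat.
Qed.

(** The factors are pairwise non-associate primes: one that is divided out is a nonzero function on
    the hyperplane of any other, so the quotient still vanishes there. *)
Lemma laur_div_pairs (I : eqType) (a b : I -> V) (L : seq I) f :
  uniq L -> (forall i, i \in L -> a i != b i) ->
  (forall i j, i \in L -> j \in L -> i != j ->
     ~~ ((a i == a j) && (b i == b j)) && ~~ ((a i == b j) && (b i == a j))) ->
  laur f ->
  (forall i, i \in L -> forall x, tor x -> x (b i) = x (a i) -> f x = 0) ->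
  exists2 g, laur g & forall x, tor x -> f x = (\prod_(i <- L) (x (b i) - x (a i))) * g x.
Proof.
elim: L f => [|i L IH] f.
  by move=> _ _ _ lf _; exists f => // x _; rewrite big_nil mul1r.
rewrite cons_uniq => /andP[iL uL] Hne Hd lf H0.
have ii : i \in i :: L by rewrite mem_head.
have abi := Hne i ii.
have [g lg Hg] : exists2 g, laur g & forall x, tor x -> f x = (x (b i) - x (a i)) * g x.
  apply: (laur_div (p := fun=> 1) (m := fun x => x (a i))) => //.
  - exact: laur_cst.
  - exact: ulaur_var.
  - by move=> x c; rewrite /upd (negbTE abi).
  - by exists (fun=> 1); [move=> u; exact: oner_neq0 | split; rewrite ?oner_neq0].
  - by move=> x hx E; rewrite (H0 i) ?mul0r.
have [g' lg' Hg'] : exists2 g', laur g' &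
    forall x, tor x -> g x = (\prod_(j <- L) (x (b j) - x (a j))) * g' x.
  apply: IH => //.
  - by move=> j jL; apply: Hne; rewrite inE jL orbT.
  - by move=> j k jL kL; apply: Hd; rewrite inE ?jL ?kL orbT.
  move=> j jL x hx Ej.
  have jL' : j \in i :: L by rewrite inE jL orbT.
  have abj := Hne j jL'.
  have ij : i != j by apply: contraNneq iL => ->.
  have [k lk Hk] : exists2 k, laur k & forall x, tor x -> g x = (x (b j) - x (a j)) * k x.
    apply: (laur_div (p := fun x => x (b i) - x (a i)) (m := fun x => x (a j))) => //.
    - by apply: laur_sub; exact: laur_var.
    - exact: ulaur_var.
    - by move=> y c; rewrite /upd (negbTE abj).
    - have nz2 : (2 : F) != 0 by rewrite pnatr_eq0.
      have nz12 : (1 : F) - 2 != 0 by rewrite -opprB oppr_eq0 -{1}[2]/(1 + 1) addrK oner_eq0.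
      have nz21 : (2 : F) - 1 != 0 by rewrite -[2]/(1 + 1) addrK oner_eq0.
      have /andP[d1 d2] := Hd i j ii jL' ij.
      (* A point with [x (a j) = x (b j)] and [x (a i) != x (b i)]: value 2 at one of [a i], [b i]
         that lies outside [{a j, b j}], and 1 elsewhere. *)
      case: (boolP ((a i == a j) || (a i == b j))) => Eai.
        exists (fun u => if u == b i then 2 else 1).
          by move=> u; case: ifP; rewrite ?oner_eq0.
        rewrite eqxx (negbTE abi); split=> //.
        have -> : (b j == b i) = false.
          apply/negbTE; apply/eqP => E; case/orP: Eai => /eqP E'.
            by move: d1; rewrite E' E !eqxx.
          by move: abi; rewrite E' E eqxx.
        have -> // : (a j == b i) = false.
        apply/negbTE; apply/eqP => E; case/orP: Eai => /eqP E'.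
          by move: abi; rewrite E' E eqxx.
        by move: d2; rewrite E' E !eqxx.
      exists (fun u => if u == a i then 2 else 1).
        by move=> u; case: ifP; rewrite ?oner_eq0.
      rewrite eqxx [b i == _]eq_sym (negbTE abi); split=> //.
      by move: Eai; rewrite negb_or ![a i == _]eq_sym => /andP[/negbTE -> /negbTE ->].
    move=> y hy Ey; rewrite mulrC -Hg //; apply: (H0 j) => //.
  by rewrite Hk // Ej subrr mul0r.
exists g' => // x hx; rewrite Hg // Hg' // big_cons; ring.
Qed.
End Division.
End Laurent.

(** * Vandermonde products and interpolation *)

Lemma laur_varV (F : numClosedFieldType) (V : finType) (v : V) :
  laur (fun x : V -> F => (x v)^-1).
Proof. by case: (ulaur_var F v). Qed.

Ltac laur_tac := repeat first
  [ exact: laur_cst | exact: laur_var | exact: laur_varV | assumption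
  | apply: laur_add | apply: laur_opp | apply: laur_mul | apply: laur_exp
  | (apply: laur_sum => ? ?) | (apply: laur_prod => ? ?) ].

Section Vandermonde.
Variables (F : numClosedFieldType) (n : nat).
Implicit Types (x z g : 'I_n -> F) (s v w : 'S_n).

Definition vand x : F := \prod_(i < n) \prod_(j < n | (i < j)%N) (x j - x i).

Lemma vand_perm x s : vand (fun i => x (s i)) = (-1) ^+ s * vand x.
Proof.
have vE y : vand y = \det (Vandermonde n (\row_i y i)).
  by rewrite det_Vandermonde; apply: eq_bigr => i _; apply: eq_bigr => j _; rewrite !mxE.
rewrite !vE; have -> : Vandermonde n (\row_i x (s i)) = col_perm s (Vandermonde n (\row_i x i)).
  by apply/matrixP => i j; rewrite !mxE.
by rewrite col_permE det_mulmx det_perm odd_permV mulrC.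
Qed.

Lemma vand_neq0 x : injective x -> vand x != 0.
Proof.
move=> xi; apply/prodf_neq0 => i _; apply/prodf_neq0 => j ij.
by rewrite subr_eq0; apply: contraTneq ij => /xi ->; rewrite ltnn.
Qed.

Lemma inj_vand x : vand x != 0 -> injective x.
Proof.
move=> /prodf_neq0 H i j E; apply/val_inj; case: (ltngtP i j) => // ij.
  by have /prodf_neq0/(_ _ ij) := H i isT; rewrite E subrr eqxx.
by have /prodf_neq0/(_ _ ij) := H j isT; rewrite E subrr eqxx.
Qed.

Lemma nzl_vand (V : finType) (c : 'I_n -> V) : injective c ->
  nzl (fun x : V -> F => vand (fun i => x (c i))).
Proof.
move=> ci; apply: nzl_prod => i _; apply: nzl_prod => j ij; apply: nzl_sub_vars.
by apply: contraTneq ij => /ci ->; rewrite ltnn.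
Qed.

Lemma vand_div (V : finType) (c : 'I_n -> V) (f : (V -> F) -> F) : injective c -> laur f ->
  (forall i j (x : V -> F), tor x -> i != j -> x (c i) = x (c j) -> f x = 0) ->
  exists2 g : (V -> F) -> F, laur g & forall x : V -> F, tor x -> f x = vand (fun i => x (c i)) * g x.
Proof.
move=> ci lf H0; pose L := enum [pred p : 'I_n * 'I_n | (p.1 < p.2)%N].
have HL p : (p \in L) = (p.1 < p.2)%N by rewrite mem_enum inE.
have [|||g lg Hg] := @laur_div_pairs F V _ (fun p => c p.1) (fun p => c p.2) L f (enum_uniq _) _ _ lf.
- by move=> p; rewrite HL => hp; apply: contraTneq hp => /ci ->; rewrite ltnn.
- move=> [i j] [k l]; rewrite !HL /= => ij kl ne; rewrite !(inj_eq ci) -!val_eqE /=.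
  move: ne; rewrite xpair_eqE -!val_eqE /=; lia.
- move=> p; rewrite HL => hp x hx E; apply: (H0 p.1 p.2) => //.
  by apply: contraTneq hp => ->; rewrite ltnn.
exists g => // x hx; rewrite Hg //; congr (_ * _).
by rewrite /vand pair_big_dep /L big_enum.
Qed.

(** Both sides have the same sum over [j], so no inequality is strict. *)
Lemma perm_ge_id s : (forall j : 'I_n, (j <= s j)%N) -> s = 1%g.
Proof.
move=> H; apply/permP => j; rewrite perm1; apply/val_inj.
have /eqP E : (\sum_(j < n) (j : nat) == \sum_(j < n) (s j : nat))%N.
  by rewrite [X in X == _](reindex_inj (@perm_inj _ s)).
have := leqif_sum (fun (j : 'I_n) (_ : true) => leqif_eq (H j)).
case=> _; rewrite E eqxx => /esym/forallP/(_ j) /= /eqP ->; by [].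
Qed.

(** Up to sign and the reversal of one set of variables, the double Schubert polynomial of the
    longest permutation. *)
Definition Dfun g z : F := \prod_(i < n) \prod_(j < n | (i < j)%N) (z j - g i).

Lemma Dfun_diag z : Dfun z z = vand z. Proof. by []. Qed.

(** If no factor vanished, [v^-1 (w j) >= j] would hold for all [j], forcing [w = v]. *)
Lemma Dfun_perm z v w : v != w -> Dfun (fun i => z (v i)) (fun i => z (w i)) = 0.
Proof.
move=> vw; suff [i [j ij E]] : exists i : 'I_n, exists2 j : 'I_n, (i < j)%N & v i = w j.
  by rewrite /Dfun (bigD1 i) //= (bigD1 j) //= E subrr !mul0r.
case: (boolP [forall j : 'I_n, (j <= (w * v^-1)%g j)%N]) => [/forallP/perm_ge_id E|].
  by case/eqP: vw; rewrite -(mulgKV v w) E mul1g.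
case/forallPn => j; rewrite -ltnNge permM => h.
by exists (v^-1%g (w j)), j => //; rewrite permKV.
Qed.

Lemma laur_D (V : finType) (c d : 'I_n -> V) :
  laur (fun x : V -> F => Dfun (fun i => x (c i)) (fun i => x (d i))).
Proof. rewrite /Dfun; laur_tac. Qed.

Lemma alternating_sum0 (H : 'S_n -> F) (t : 'S_n) :
  (forall w, H (w * t)%g = - H w) -> \sum_w H w = 0.
Proof.
move=> Ht; have : \sum_w H w = - \sum_w H w.
  by rewrite {1}(reindex_inj (mulIg t)) /= -sumrN; apply: eq_bigr => w _; rewrite Ht.
by move/eqP; rewrite -addr_eq0 -mulr2n mulrn_eq0 => /eqP.
Qed.

Lemma signMtperm w (a b : 'I_n) : a != b ->
  (-1) ^+ (w * tperm a b)%g = - (-1) ^+ w :> F.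
Proof. by move=> ab; rewrite odd_permM odd_tperm ab addbT; case: (odd_perm w); rewrite ?expr0 ?expr1 ?opprK. Qed.

Lemma comp_tperm z (a b : 'I_n) : z a = z b -> forall i, z (tperm a b i) = z i.
Proof. by move=> E i; case: tpermP => [->|->|]. Qed.
End Vandermonde.

(** * Interpolation along the orbit of [z] *)

Section Vars.
Variables (F : numClosedFieldType) (n : nat).
Implicit Types (f r : ('I_n -> F) -> F -> F) (p : ('I_n -> F) -> ('I_n -> F) -> F -> F).

Definition pack2 (z : 'I_n -> F) (h : F) : 'I_n + unit -> F :=
  fun v => match v with inl i => z i | inr _ => h end.
Definition pack3 (g z : 'I_n -> F) (h : F) : 'I_n + ('I_n + unit) -> F :=
  fun v => match v with inl i => g i | inr u => pack2 z h u end.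
Definition laur2 f := laur (fun x : 'I_n + unit -> F => f (fun i => x (inl i)) (x (inr tt))).
Definition laur3 p := laur (fun x : 'I_n + ('I_n + unit) -> F =>
   p (fun i => x (inl i)) (fun i => x (inr (inl i))) (x (inr (inr tt)))).

Lemma tor_pack2 z h : torus z -> h != 0 -> tor (pack2 z h).
Proof. by move=> hz hh [i|[]] //=; exact: hz. Qed.
Lemma tor_pack3 g z h : torus g -> torus z -> h != 0 -> tor (pack3 g z h).
Proof. by move=> hg hz hh [i|[i|[]]] //=. Qed.

Lemma mono_pack2 e z h :
  mono e (pack2 z h) = mon (fun i => e (inl i)) z * h ^ e (inr tt).
Proof.
rewrite /mono big_sumType /=; congr (_ * _).
by rewrite (bigD1 tt) //= big1 ?mulr1 // => -[].
Qed.

Lemma mono_pack3 e g z h :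
  mono e (pack3 g z h) = mon (fun i => e (inl i)) g *
    mon (fun i => e (inr (inl i))) z * h ^ e (inr (inr tt)).
Proof.
rewrite /mono big_sumType /= -mulrA; congr (_ * _).
exact: (mono_pack2 (fun u => e (inr u))).
Qed.

Lemma laur2P f : laur2 f <-> laurent_zh f.
Proof.
split=> -[L HL].
  exists [seq (t.1, fun i => t.2 (inl i), t.2 (inr tt)) | t <- L] => z h hz hh.
  rewrite big_map /= (HL _ (tor_pack2 hz hh)) /=.
  by apply: eq_bigr => t _; rewrite mono_pack2 mulrA.
have : laur (fun x : 'I_n + unit -> F => \sum_(t <- L) t.1.1 *
    mon t.1.2 (fun i => x (inl i)) * x (inr tt) ^ t.2).
  apply: laur_sum => t _; apply: laur_mul; last by apply: laur_expz; exact: ulaur_var.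
  apply: laur_mul; first exact: laur_cst.
  by apply: laur_prod => i _; apply: laur_expz; exact: ulaur_var.
by move/laur_eq; apply=> x hx; rewrite HL.
Qed.

Lemma laur3P p : laur3 p <-> laurent_Gzh p.
Proof.
split=> -[L HL].
  exists [seq (t.1, fun i => t.2 (inl i), fun i => t.2 (inr (inl i)), t.2 (inr (inr tt))) | t <- L].
  move=> g z h hg hz hh; rewrite big_map /= (HL _ (tor_pack3 hg hz hh)) /=.
  by apply: eq_bigr => t _; rewrite mono_pack3 !mulrA.
have : laur (fun x : 'I_n + ('I_n + unit) -> F => \sum_(t <- L) t.1.1.1 *
    mon t.1.1.2 (fun i => x (inl i)) * mon t.1.2 (fun i => x (inr (inl i))) * x (inr (inr tt)) ^ t.2).
  apply: laur_sum => t _; apply: laur_mul; last by apply: laur_expz; exact: ulaur_var.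
  apply: laur_mul; last by apply: laur_prod => i _; apply: laur_expz; exact: ulaur_var.
  apply: laur_mul; first exact: laur_cst.
  by apply: laur_prod => i _; apply: laur_expz; exact: ulaur_var.
by move/laur_eq; apply=> x hx; rewrite HL.
Qed.

Lemma laur2_eq f r : laur2 f -> (forall z h, torus z -> h != 0 -> r z h = f z h) -> laur2 r.
Proof. by move=> lf E; apply: (laur_eq lf) => x hx; rewrite E. Qed.

Lemma laur2_domE f g (p : ('I_n -> F) -> F -> F) : laur2 f -> laur2 g -> laur2 p ->
  (exists z h, [/\ torus z, h != 0 & p z h != 0]) ->
  (forall z h, torus z -> h != 0 -> p z h != 0 -> f z h = g z h) ->
  forall z h, torus z -> h != 0 -> f z h = g z h.
Proof.
move=> lf lg lp [z0 [h0 [hz0 hh0 p0]]] H z h hz hh.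
apply: (laur_domE lf lg lp _ _ (tor_pack2 hz hh)).
  by exists (pack2 z0 h0) => //; exact: tor_pack2.
by move=> x hx px; apply: H.
Qed.

Lemma laur2_vand_domE f g : laur2 f -> laur2 g ->
  (forall z h, torus z -> h != 0 -> injective z -> f z h = g z h) ->
  forall z h, torus z -> h != 0 -> f z h = g z h.
Proof.
move=> lf lg H.
have [lv [x hx vx]] : nzl (fun x : 'I_n + unit -> F => vand (fun i => x (inl i))).
  by apply: nzl_vand => i j [].
apply: (@laur2_domE f g (fun z _ => vand z)) => //.
  by exists (fun i => x (inl i)), (x (inr tt)); split=> //; exact: hx.
by move=> z h hz hh /inj_vand; exact: H.
Qed.

Lemma laur3_subst2 p (c : 'I_n -> 'I_n) :
  laur3 p -> laur2 (fun z h => p (fun i => z (c i)) z h).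
Proof.
move=> lp; have := laur_subst (g := fun (v : 'I_n + ('I_n + unit)) (x : 'I_n + unit -> F) =>
  match v with inl i => x (inl (c i)) | inr u => x u end) lp.
by apply=> -[i|u]; exact: ulaur_var.
Qed.

Lemma laur2_weak f : laur2 f -> laur3 (fun _ z h => f z h).
Proof.
move=> lf; have := laur_subst (g := fun (v : 'I_n + unit) (x : 'I_n + ('I_n + unit) -> F) =>
  x (inr v)) lf.
by apply=> u; exact: ulaur_var.
Qed.

(* Lagrange interpolation on the orbit of [z]: [Dfun g (z o w) / vand (z o w)]
   is 1 at [g = z o w] and 0 at the other points of the orbit. *)
Lemma interpolation (r : 'S_n -> ('I_n -> F) -> F -> F) :
  (forall w, laur2 (r w)) ->
  (forall w a b z h, torus z -> h != 0 -> z a = z b -> r (w * tperm a b)%g z h = r w z h) ->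
  exists2 k, laur3 k & forall (v : 'S_n) z h, torus z -> h != 0 -> k (fun i => z (v i)) z h = r v z h.
Proof.
move=> lr gkm.
(* As [vand (z o w) = (-1)^w vand z], this is the interpolation sum over the common denominator
   [vand z]. *)
pose num (x : 'I_n + ('I_n + unit) -> F) : F := \sum_w (-1) ^+ (w : 'S_n) *
  r w (fun i => x (inr (inl i))) (x (inr (inr tt))) *
  Dfun (fun i => x (inl i)) (fun i => x (inr (inl (w i)))).
have lnum : laur num.
  apply: laur_sum => w _; apply: laur_mul; last exact: laur_D.
  by apply: laur_mul; [exact: laur_cst | exact: (laur2_weak (lr w))].
have [||k lk Hk] := vand_div (c := fun i => inr (inl i)) _ lnum.
- by move=> i j [].
(* Where [z_i = z_j], the hypothesis on [r] makes the terms of [w] and [w * tperm i j] cancel. *)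
- move=> i j x hx ij E; apply: (alternating_sum0 (t := tperm i j)) => w.
  rewrite gkm // signMtperm //.
  rewrite !mulNr; congr (- (_ * _)); congr Dfun.
  by apply: functional_extensionality => l; rewrite permM (comp_tperm (z := fun i => x (inr (inl i)))).
exists (fun g z h => k (pack3 g z h)).
  apply: (laur_eq lk) => x hx; congr k; apply: functional_extensionality.
  by case=> [i|[i|[]]].
move=> v; apply: laur2_vand_domE => //.
  apply: (laur3_subst2 (p := fun g z h => k (pack3 g z h))).
  apply: (laur_eq lk) => x hx; congr k; apply: functional_extensionality.
  by case=> [i|[i|[]]].
move=> z h hz hh zi; apply: (mulfI (vand_neq0 zi)).
have hzv : torus (fun i => z (v i)) by move=> i; exact: hz.
rewrite -(Hk _ (tor_pack3 hzv hz hh)) /num /= (bigD1 v) //= big1 ?addr0; last first.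
  by move=> w wv; rewrite Dfun_perm 1?eq_sym // mulr0.
rewrite (_ : Dfun _ _ = vand (fun i => z (v i))) // vand_perm.
by case: (odd_perm v); rewrite ?expr0 ?expr1; ring.
Qed.

(** [S] is, up to sign, 0 or a Schur function in bialternant form with shifted exponent vector [e],
    negative entries allowed. *)
Lemma alternant_quotient (e : 'I_n -> int) : exists S : ('I_n -> F) -> F,
  [/\ laurent_z S, sym_z S & forall z, torus z ->
     vand z * S z = \sum_(w : 'S_n) (-1) ^+ w * mon e (fun i => z (w i))].
Proof.
pose num (x : 'I_n -> F) : F := \sum_(w : 'S_n) (-1) ^+ w * mon e (fun i => x (w i)).
have lnum : laur num.
  apply: laur_sum => w _; apply: laur_mul; first exact: laur_cst.
  by apply: laur_prod => i _; apply: laur_expz; exact: ulaur_var.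
have [||S lS HS] := vand_div (c := id) _ lnum; first by [].
  move=> i j x hx ij E; apply: (alternating_sum0 (t := tperm i j)) => w.
  rewrite signMtperm // mulNr; congr (- (_ * mon _ _)).
  by apply: functional_extensionality => l; rewrite permM comp_tperm.
exists S; split=> // [s|z hz]; last by rewrite -HS.
have lS' : laur (fun z => S (fun i => z (s i))).
  exact: (laur_subst (g := fun i x => x (s i)) lS (fun i => ulaur_var F (s i))).
have [lv ev] : nzl (fun x : 'I_n -> F => vand x) by apply: (@nzl_vand F n _ id).
apply: (laur_domE lS' lS lv ev) => z hz vz; apply: (mulfI vz).
have hzs : tor (fun i => z (s i)) by move=> i; exact: hz.
rewrite -[in RHS]HS // /num.
have := HS _ hzs; rewrite vand_perm /num => E.
have {E} : vand z * S (fun i => z (s i)) = (-1) ^+ s *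
   \sum_(w : 'S_n) (-1) ^+ w * mon e (fun i => z (s (w i))).
  by rewrite E !mulrA -signr_addb addbb expr0 mul1r.
move=> ->; rewrite mulr_sumr [RHS](reindex_inj (mulIg s)) /=.
apply: eq_bigr => w _; rewrite odd_permM signr_addb mulrA [_ * (-1) ^+ w]mulrC.
by congr (_ * mon _ _); apply: functional_extensionality => i; rewrite permM.
Qed.
End Vars.

(** * The ideal of relations *)

Section Ideal.
Variables (F : numClosedFieldType) (N n : nat) (lam : 'I_N -> nat).
Implicit Types (p q : ('I_n -> F) -> ('I_n -> F) -> F -> F).

Definition Slam := [set s : 'S_n | [forall i : 'I_n, gblk lam (s i) == gblk lam i]].

Lemma SlamP (s : 'S_n) :
  reflect (forall i : 'I_n, gblk lam (s i) = gblk lam i) (s \in Slam).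
Proof. by rewrite inE; apply: 'forall_eqP. Qed.

Lemma Slam1 : 1%g \in Slam.
Proof. by apply/SlamP => i; rewrite perm1. Qed.

Lemma SlamM s t : s \in Slam -> t \in Slam -> (s * t)%g \in Slam.
Proof. by move=> /SlamP hs /SlamP ht; apply/SlamP => i; rewrite permM ht hs. Qed.

Lemma SlamV s : s \in Slam -> (s^-1)%g \in Slam.
Proof. by move=> /SlamP hs; apply/SlamP => i; rewrite -hs permKV. Qed.

Lemma card_Slam_neq0 : (#|Slam|%:R : F) != 0.
Proof. by rewrite pnatr_eq0 -lt0n; apply/card_gt0P; exists 1%g; exact: Slam1. Qed.

(** Reynolds operator of [S_lambda]: interpolation and the kernel expansion produce functions
    without the symmetry that [KT] demands. *)
Definition avg p : ('I_n -> F) -> ('I_n -> F) -> F -> F :=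
  fun g z h => #|Slam|%:R^-1 * \sum_(s in Slam) p (fun i => g (s i)) z h.

Lemma laur3_perm p (s : 'S_n) : laur3 p -> laur3 (fun g z h => p (fun i => g (s i)) z h).
Proof.
move=> lp; have := laur_subst (g := fun (v : 'I_n + ('I_n + unit)) (x : 'I_n + ('I_n + unit) -> F) =>
  match v with inl i => x (inl (s i)) | inr u => x (inr u) end) lp.
by apply=> -[i|u]; exact: ulaur_var.
Qed.

Lemma KT_avg p : laur3 p -> KT lam (avg p).
Proof.
move=> lp; split.
  apply/laur3P; apply: laur_mul; first exact: laur_cst.
  by apply: laur_sum => s _; exact: (laur3_perm s lp).
move=> s hs g z h _ _ _; congr (_ * _).
have hS : s \in Slam by apply/SlamP.
rewrite [RHS](reindex_inj (mulIg s)) /=.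
apply: eq_big => t; last first.
  by move=> _; congr p; apply: functional_extensionality => i; rewrite permM.
apply/idP/idP => ht; first exact: SlamM.
by rewrite -(mulgK s t); apply: SlamM => //; exact: SlamV.
Qed.

Lemma avg_inv p g z h : KTinv lam p -> torus g -> torus z -> h != 0 ->
  avg p g z h = p g z h.
Proof.
move=> ip hg hz hh; rewrite /avg (eq_bigr (fun=> p g z h)); last first.
  by move=> s /SlamP hs; exact: ip.
by rewrite sumr_const -[p _ _ _ *+ _]mulr_natl mulrA mulVf ?mul1r // card_Slam_neq0.
Qed.

Lemma In_cat (T : Type) (x : T) s1 s2 : List.In x (s1 ++ s2) -> List.In x s1 \/ List.In x s2.
Proof.
elim: s1 => [|y s IH] /=; first by right.
by case=> [->|/IH[h|h]]; [left; left | left; right | right].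
Qed.

Lemma In_map (A B : Type) (f : A -> B) y s : List.In y (map f s) -> exists x, y = f x.
Proof. by elim: s => //= x s IH [<-|/IH //]; exists x. Qed.

Lemma In_allpairs (A B C : Type) (f : A -> B -> C) c s t :
  List.In c [seq f a b | a <- s, b <- t] -> exists a b, c = f a b.
Proof.
elim: s => //= a s IH H; have [H1|H1] := In_cat H; last exact: IH.
by have [b ->] := In_map H1; exists a, b.
Qed.

(* [Dfun] is a reproducing kernel: antisymmetrising [p * Dfun] in [g] recovers
   [vand * p], and antisymmetrising along the orbit of [z] gives 0. *)
Lemma vanishing_in_ideal p : laur3 p -> KTinv lam p ->
  (forall (w : 'S_n) z h, torus z -> h != 0 -> p (fun i => z (w i)) z h = 0) ->
  in_ideal lam p.
Proof.
move=> lp ip p0.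
have [S HS] := functional_choice _ (@alternant_quotient F n).
have [Lp HLp] := (laur3P p).1 lp.
have [LD HLD] := laur_D F (@inl 'I_n 'I_n) (@inr 'I_n 'I_n).
have DE g z : torus g -> torus z -> Dfun g z =
    \sum_(u <- LD) u.1 * mon (fun i => u.2 (inl i)) g * mon (fun i => u.2 (inr i)) z.
  move=> hg hz; pose x v := match v with inl i => g i | inr i => z i end.
  have hx : tor x by case=> i; [exact: hg | exact: hz].
  have -> : Dfun g z = Dfun (fun i => x (inl i)) (fun i => x (inr i)) by [].
  rewrite HLD //; apply: eq_bigr => u _; rewrite -mulrA; congr (_ * _).
  by rewrite /mono big_sumType.
(* A monomial of [p] and one of [Dfun] together split into [co], free of the variable [x] to be
   antisymmetrised, and the exponent [ex] in [x], whose alternant is [vand x * S]. *)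
pose co (t : F * ('I_n -> int) * ('I_n -> int) * int) (u : F * ('I_n + 'I_n -> int)) :=
  fun (g z : 'I_n -> F) (h : F) =>
  t.1.1.1 * mon t.1.2 z * h ^ t.2 * (u.1 * mon (fun i => u.2 (inl i)) g).
pose ex (t : F * ('I_n -> int) * ('I_n -> int) * int) (u : F * ('I_n + 'I_n -> int)) :=
  fun i => t.1.1.2 i + u.2 (inr i).
have lco t u : laur3 (co t u).
  rewrite /laur3 /co; repeat apply: laur_mul; try exact: laur_cst;
    try (apply: laur_prod => i _); apply: laur_expz; exact: ulaur_var.
have key (x g z : 'I_n -> F) h : torus x -> torus g -> torus z -> h != 0 ->
    vand x * (\sum_(t <- Lp) \sum_(u <- LD) co t u g z h * S (ex t u) x)
    = \sum_(w : 'S_n) (-1) ^+ w * (p (fun i => x (w i)) z h * Dfun g (fun i => x (w i))).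
  move=> hx hg hz hh; rewrite mulr_sumr.
  under eq_bigr => t _.
    rewrite mulr_sumr; under eq_bigr => u _.
      have [_ _ HSx] := HS (ex t u); rewrite mulrCA HSx // mulr_sumr; over.
    rewrite exchange_big; over.
  rewrite exchange_big; apply: eq_bigr => w _ /=.
  have hxw : torus (fun i => x (w i)) by move=> i; exact: hx.
  rewrite HLp // DE // mulr_suml mulr_sumr; apply: eq_bigr => t _.
  rewrite !mulr_sumr; apply: eq_bigr => u _.
  have -> : mon (ex t u) (fun i => x (w i)) = mon t.1.1.2 (fun i => x (w i)) *
      mon (fun i => u.2 (inr i)) (fun i => x (w i)) by exact: monoD.
  rewrite /co; move: (mon _ _) (mon _ _) (mon _ _) (mon _ _) (h ^ _) ((-1) ^+ _) => m1 m2 m3 m4 m5 m6.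
  ring.
(* At [x = g] the kernel [Dfun g (g o w)] leaves only [w = 1], with the value [vand g]. *)
have keyg g z h : torus g -> torus z -> h != 0 ->
    p g z h = \sum_(t <- Lp) \sum_(u <- LD) co t u g z h * S (ex t u) g.
  move=> hg hz hh.
  have lS (t : F * ('I_n -> int) * ('I_n -> int) * int) (u : F * ('I_n + 'I_n -> int)) :
      laur3 (fun g _ _ => S (ex t u) g).
    have [lS _ _] := HS (ex t u).
    exact: (laur_subst (g := fun i (x : 'I_n + ('I_n + unit) -> F) => x (inl i)) lS
              (fun i => ulaur_var F _)).
  have ls : laur3 (fun g z h => \sum_(t <- Lp) \sum_(u <- LD) co t u g z h * S (ex t u) g).
    apply: laur_sum => t _; apply: laur_sum => u _; apply: laur_mul; [exact: lco | exact: lS].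
  have [lv ev] : nzl (fun x : 'I_n + ('I_n + unit) -> F => vand (fun i => x (inl i))).
    by apply: nzl_vand => i j [].
  apply: (laur_domE lp ls lv ev _ (tor_pack3 hg hz hh)) => x hx vx.
  apply: (mulfI vx); rewrite key //; try (move=> i; exact: hx).
  rewrite (bigD1 1%g) //= big1 ?addr0; last first.
    move=> w w1; rewrite -{1}(_ : (fun i => x (inl ((1%g : 'S_n) i))) = (fun i => x (inl i))).
      by rewrite (Dfun_perm (fun i => x (inl i))) 1?eq_sym // !mulr0.
    by apply: functional_extensionality => i; rewrite perm1.
  rewrite odd_perm1 expr0 mul1r (_ : (fun i => x (inl ((1%g : 'S_n) i))) = (fun i => x (inl i))).
    by rewrite Dfun_diag mulrC.
  by apply: functional_extensionality => i; rewrite perm1.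
(* At [x = z] each summand contains [p (z o w) z h = 0]. Subtracting this from the expansion at [g]
   exhibits [p] as a sum of [co * (S g - S z)]. *)
have keyz g z h : torus g -> torus z -> h != 0 ->
    \sum_(t <- Lp) \sum_(u <- LD) co t u g z h * S (ex t u) z = 0.
  move=> hg hz hh.
  have lSz (t : F * ('I_n -> int) * ('I_n -> int) * int) (u : F * ('I_n + 'I_n -> int)) :
      laur3 (fun _ z _ => S (ex t u) z).
    have [lS _ _] := HS (ex t u).
    exact: (laur_subst (g := fun i (x : 'I_n + ('I_n + unit) -> F) => x (inr (inl i))) lS
              (fun i => ulaur_var F _)).
  have ls : laur3 (fun g z h => \sum_(t <- Lp) \sum_(u <- LD) co t u g z h * S (ex t u) z).
    apply: laur_sum => t _; apply: laur_sum => u _; apply: laur_mul; [exact: lco | exact: lSz].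
  have [lv ev] : nzl (fun x : 'I_n + ('I_n + unit) -> F => vand (fun i => x (inr (inl i)))).
    by apply: nzl_vand => i j [].
  apply: (laur_dom ls lv ev _ (tor_pack3 hg hz hh)) => x hx vx.
  apply: (mulfI vx); rewrite key //; try (move=> i; exact: hx).
  rewrite mulr0 big1 // => w _; rewrite (p0 w (fun i => x (inr (inl i)))) ?mul0r ?mulr0 //.
exists [seq (avg (co t u), S (ex t u)) | t <- Lp, u <- LD]; split.
  move=> c f H; have [t [u [-> ->]]] := In_allpairs H; have [h1 h2 _] := HS (ex t u).
  split=> //; exact: KT_avg.
(* [p] is invariant and each [S] is symmetric, so averaging over [S_lambda] changes only the
   coefficients. *)
move=> g z h hg hz hh; rewrite -(avg_inv ip) // big_allpairs_dep /=.
under [RHS]eq_bigr => t _.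
  under eq_bigr => u _ do rewrite /avg -mulrA mulr_suml.
  rewrite -mulr_sumr exchange_big /=; over.
rewrite -mulr_sumr exchange_big /=; congr (_ * _); apply: eq_bigr => s hs.
have hgs : torus (fun i => g (s i)) by move=> i; exact: hg.
transitivity (\sum_(t <- Lp) \sum_(u <- LD) co t u (fun i => g (s i)) z h * S (ex t u) (fun i => g (s i))
  - \sum_(t <- Lp) \sum_(u <- LD) co t u (fun i => g (s i)) z h * S (ex t u) z).
  by rewrite keyz // subr0 keyg.
rewrite -sumrB; apply: eq_bigr => t _.
rewrite -sumrB; apply: eq_bigr => u _; rewrite -mulrBr; congr (_ * (_ - _)).
by have [_ h2 _] := HS (ex t u); exact: h2.
Qed.

End Ideal.

(** * Fixed points *)

Section Blocks.
Variables (N n : nat) (lam : 'I_N -> nat).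
Hypothesis Hn : (\sum_(k < N) lam k)%N = n.

Lemma Lsum_mono j k : (j <= k)%N -> (Lsum lam j <= Lsum lam k)%N.
Proof.
move=> jk; rewrite /Lsum [X in (_ <= X)%N](bigID (fun i : 'I_N => (i <= j)%N)) /=.
rewrite [X in (_ <= X + _)%N](eq_bigl (fun i : 'I_N => (i <= j)%N)) ?leq_addr // => i.
by case: (leqP i j) => h; rewrite ?andbF // (leq_trans h jk).
Qed.

Lemma Lsum_Lpre j k : (j < k)%N -> (Lsum lam j <= Lpre lam k)%N.
Proof.
case: k => // k; rewrite ltnS => jk; apply: (leq_trans (Lsum_mono jk)).
by rewrite /Lsum /Lpre.
Qed.

Lemma Lsum_split (k : 'I_N) : Lsum lam k = (Lpre lam k + lam k)%N.
Proof.
rewrite /Lsum (bigD1 k) //= addnC; congr (_ + _)%N; apply: eq_bigl => j.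
by rewrite ltn_neqAle andbC -val_eqE.
Qed.

Lemma Lsum_last : Lsum lam N.-1 = n.
Proof. by rewrite -[RHS]Hn; apply: eq_bigl => i; have := ltn_ord i; lia. Qed.

Lemma Lsum_le k : (Lsum lam k <= n)%N.
Proof. by rewrite -[X in (_ <= X)%N]Hn /Lsum [X in (_ <= X)%N](bigID (fun i : 'I_N => (i <= k)%N)) /= leq_addr. Qed.

Lemma gblk_eq (i : nat) (k : 'I_N) : (Lpre lam k <= i < Lsum lam k)%N -> gblk lam i = k.
Proof.
case/andP=> h1 h2; rewrite /gblk -[RHS](card_ord k) -[in RHS](card_codom (f := widen_ord (ltnW (ltn_ord k)))); last first.
  by move=> a b /(congr1 val) /= /val_inj.
apply: eq_card => j; rewrite inE; apply/idP/codomP => [h|[a ->]].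
  have jk : (j < k)%N.
    by rewrite ltnNge; apply/negP => kj; have := Lsum_mono kj; lia.
  by exists (Ordinal jk); apply: val_inj.
by apply: leq_trans h1; apply: Lsum_Lpre => /=.
Qed.

Lemma gblk_ex (i : 'I_n) : exists2 k : 'I_N, gblk lam i = k & (Lpre lam k <= i < Lsum lam k)%N.
Proof.
have ex : exists k, (i < Lsum lam k)%N by exists N.-1; rewrite Lsum_last.
case: (ex_minnP ex) => k ik min.
have N0 : (0 < N)%N.
  case: N lam Hn ik => // lam0; rewrite big_ord0 => E; have := ltn_ord i; lia.
have kN : (k < N)%N.
  have : (k <= N.-1)%N by apply: min; rewrite Lsum_last.
  lia.
have h : (Lpre lam (Ordinal kN) <= i < Lsum lam (Ordinal kN))%N.
  rewrite /= ik andbT; case: k ik min kN => [|k] ik min kN.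
    by rewrite /Lpre big_pred0.
  by rewrite leqNgt; apply/negP => /min; rewrite ltnn.
by exists (Ordinal kN) => //; exact: gblk_eq.
Qed.

Lemma gblk_lt (i : 'I_n) : (gblk lam i < N)%N.
Proof. by have [k -> _] := gblk_ex i. Qed.

Definition blk (i : 'I_n) : 'I_N := Ordinal (gblk_lt i).

Lemma card_gblk (k : 'I_N) : #|[pred i : 'I_n | gblk lam i == k]| = lam k.
Proof.
have le : (Lpre lam k + lam k <= n)%N by rewrite -Lsum_split Lsum_le.
have hf (a : 'I_(lam k)) : (Lpre lam k + a < n)%N by have := ltn_ord a; lia.
rewrite -[RHS]card_ord -(card_codom (f := fun a => Ordinal (hf a))); last first.
  by move=> a b /(congr1 val) /= /addnI /val_inj.
apply: eq_card => i; rewrite inE; apply/eqP/codomP => [E|[a ->]].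
  have [k' E' /andP[h1]] := gblk_ex i; have {}E' : k' = k by apply: val_inj => /=; rewrite -E' E.
  rewrite E' Lsum_split in h1 * => h2.
  have ha : (i - Lpre lam k < lam k)%N by lia.
  by exists (Ordinal ha); apply: val_inj => /=; lia.
by apply: gblk_eq; rewrite Lsum_split /=; have := ltn_ord a; lia.
Qed.

(** The fixed point whose restriction substitutes [z (w i)] for the [i]-th [Gamma], up to the order
    inside blocks. *)
Definition Jof (w : 'S_n) : {ffun 'I_n -> 'I_N} := [ffun x => blk ((w^-1)%g x)].

Lemma Jof_part w : is_part lam (Jof w).
Proof.
move=> k; rewrite -card_gblk -[RHS](card_image (@perm_inj _ w)); apply: eq_card => x.
rewrite [LHS]inE; apply/idP/imageP => [h|[i h ->]].
  exists ((w^-1)%g x); last by rewrite permKV.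
  by rewrite inE; move: h; rewrite ffunE -val_eqE.
by rewrite ffunE permK -val_eqE.
Qed.

Lemma Jof_eq (J : {ffun 'I_n -> 'I_N}) (w : 'S_n) :
  (forall i, nat_of_ord (J (w i)) = gblk lam i) -> Jof w = J.
Proof.
by move=> H; apply/ffunP => x; apply: val_inj; rewrite ffunE /= -H permKV.
Qed.

(** Identifies restriction to a fixed point with evaluation at a point of the [S_n]-orbit of [z]. *)
Lemma Gam_perm (J : {ffun 'I_n -> 'I_N}) : is_part lam J -> exists w : 'S_n,
  (forall i, nat_of_ord (J (w i)) = gblk lam i) /\
  forall (F : numClosedFieldType) (z : 'I_n -> F), Gam lam J z = fun i => z (w i).
Proof.
move=> pJ; pose s (k : nat) := [seq x <- enum 'I_n | nat_of_ord (J x) == k].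
have sz (i : 'I_n) : (gpos lam i < size (s (gblk lam i)))%N.
  have [k Ek /andP[h1 h2]] := gblk_ex i; rewrite /gpos Ek.
  have -> : size (s k) = lam k.
    have -> : s k = enum [pred x | J x == k] by rewrite /s enumT; apply: eq_filter => x; exact: val_eqE.
    by rewrite -cardE pJ.
  by rewrite Lsum_split in h2; lia.
pose f (i : 'I_n) := nth i (s (gblk lam i)) (gpos lam i).
have fJ i : nat_of_ord (J (f i)) = gblk lam i.
  by have := mem_nth i (sz i); rewrite mem_filter => /andP[/eqP].
have fi : injective f.
  move=> i j E; have Eb : gblk lam i = gblk lam j by rewrite -!fJ E.
  have [k Ek /andP[h1 h2]] := gblk_ex i.
  have [k' Ek' /andP[h1' h2']] := gblk_ex j.
  have Ekk : k = k' by apply: val_inj => /=; rewrite -Ek -Ek'.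
  move: E; rewrite /f -Eb (set_nth_default j) ?sz // => /eqP.
  rewrite nth_uniq ?sz //; first last.
  - by rewrite filter_uniq ?enum_uniq.
  - by rewrite Eb sz.
  rewrite /gpos -Eb Ek => /eqP E; apply: val_inj => /=; subst k'; lia.
exists (perm fi); split=> [i|F z]; first by rewrite permE fJ.
by apply: functional_extensionality => i; rewrite /Gam (nth_map i) ?sz // permE.
Qed.
End Blocks.

(** * Classes and their restrictions *)

Section Geometry.
Variables (F : numClosedFieldType) (N n : nat) (lam : 'I_N -> nat).
Hypothesis Hn : (\sum_(k < N) lam k)%N = n.

Lemma restr_perm_eq (p : ('I_n -> F) -> ('I_n -> F) -> F -> F) J (w : 'S_n) z h :
  KTinv lam p -> is_part lam J -> (forall i, nat_of_ord (J (w i)) = gblk lam i) ->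
  torus z -> h != 0 -> restr lam p J z h = p (fun i => z (w i)) z h.
Proof.
move=> ip pJ Hw hz hh; have [w' [Hw' HG]] := Gam_perm Hn pJ; rewrite /restr HG.
have {1}-> : (fun i => z (w i)) = (fun i => z (w' ((w * w'^-1)%g i))).
  by apply: functional_extensionality => i; rewrite permM permKV.
rewrite (ip (w * w'^-1)%g _ (fun i => z (w' i))) // => i.
by rewrite permM -Hw' permKV Hw.
Qed.

(** Gluing along the hyperplanes [z_a = z_b]: interpolation yields a function with the right values
    on the orbit, and averaging makes it a class. *)
Lemma class_of_restrictions (r : {ffun 'I_n -> 'I_N} -> ('I_n -> F) -> F -> F) :
  (forall J, is_part lam J -> laur2 (r J)) ->
  (forall J a b z h, is_part lam J -> torus z -> h != 0 -> z a = z b ->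
     r [ffun x => J (tperm a b x)] z h = r J z h) ->
  exists2 k, KT lam k & forall J, is_part lam J -> forall z h, torus z -> h != 0 ->
    restr lam k J z h = r J z h.
Proof.
move=> lr gkm.
have [w|w a b z h hz hh E|k lk Hk] := @interpolation F n (fun w => r (Jof Hn w)).
- by apply: lr; exact: Jof_part.
- rewrite -(gkm (Jof Hn w) a b) //; last exact: Jof_part.
  congr (r _ z h); apply/ffunP => x; rewrite !ffunE; congr blk.
  by rewrite invMg permM tpermV.
exists (avg lam k); first exact: KT_avg.
move=> J pJ z h hz hh; have [w [Hw _]] := Gam_perm Hn pJ.
have [_ ik] := KT_avg lam lk.
rewrite (restr_perm_eq ik pJ Hw) // /avg.
rewrite (eq_bigr (fun=> r J z h)).
  by rewrite sumr_const -[r _ _ _ *+ _]mulr_natl mulrA mulVf ?mul1r // card_Slam_neq0.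
(* [s * w] selects the same fixed point as [w], so averaging does not alter the interpolated
   value. *)
move=> s /SlamP hs.
have -> : (fun i => z (w (s i))) = (fun i => z ((s * w)%g i)).
  by apply: functional_extensionality => i; rewrite permM.
rewrite Hk //; congr (r _ z h); apply: Jof_eq => i.
by rewrite permM Hw hs.
Qed.

(** The generic points contain the complement of a hypersurface, so density applies to identities
    known only where [Wt] is meaningful. *)
Lemma genericP : exists2 p : ('I_n -> F) -> F -> F, laur2 p /\
   (exists z h, [/\ torus z, h != 0 & p z h != 0]) &
   forall z h, torus z -> h != 0 -> p z h != 0 -> generic z h.
Proof.
pose p (x : 'I_n + unit -> F) := vand (fun i => x (inl i)) * (x (inr tt) - 1) *
  \prod_a \prod_b (x (inl a) - x (inr tt) * x (inl b)).
have n2 : (2 : F) != 0 by rewrite pnatr_eq0.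
have n21 : (2 : F) - 1 != 0 by rewrite -[2]/(1 + 1) addrK oner_eq0.
have [lp [x hx px]] : nzl p.
  apply: nzl_mul; first apply: nzl_mul.
  - by apply: nzl_vand => i j [].
  - split; first by laur_tac.
    by exists (fun=> 2).
  apply: nzl_prod => a _; apply: nzl_prod => b _; split; first by laur_tac.
  exists (pack2 (fun=> 1) 2) => /=.
    by apply: tor_pack2 => // i; exact: oner_neq0.
  by rewrite mulr1 -opprB oppr_eq0.
exists (fun z h => p (pack2 z h)).
  split.
    apply: (laur_eq lp) => y _; congr p; apply: functional_extensionality.
    by case=> [i|[]].
  exists (fun i => x (inl i)), (x (inr tt)); split; try exact: hx.
    by move=> i; exact: hx.
  rewrite (_ : pack2 _ _ = x) //; apply: functional_extensionality.
  by case=> [i|[]].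
move=> z h hz hh; rewrite /p !mulf_eq0 !negb_or /= => /andP[/andP[/inj_vand zi h1] /prodf_neq0 H].
split=> //; first by rewrite -subr_eq0.
move=> a b; rewrite -subr_eq0.
by have /prodf_neq0/(_ b isT) := H a isT.
Qed.

Lemma laur2_generic_domE (f g : ('I_n -> F) -> F -> F) : laur2 f -> laur2 g ->
  (forall z h, generic z h -> f z h = g z h) ->
  forall z h, torus z -> h != 0 -> f z h = g z h.
Proof.
move=> lf lg H; have [p [lp ep] Hp] := genericP.
by apply: (laur2_domE lf lg lp ep) => z h hz hh pz; apply: H; exact: Hp.
Qed.

Lemma laur2_restr (p : ('I_n -> F) -> ('I_n -> F) -> F -> F) J :
  KT lam p -> is_part lam J -> laur2 (restr lam p J).
Proof.
move=> [/laur3P lp _] pJ; have [w [_ Hw]] := Gam_perm Hn pJ.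
apply: (laur2_eq (laur3_subst2 w lp)) => z h _ _; by rewrite /restr Hw.
Qed.

Lemma restr_eq0_in_ideal (p : ('I_n -> F) -> ('I_n -> F) -> F -> F) : KT lam p ->
  (forall J, is_part lam J -> forall z h, generic z h -> restr lam p J z h = 0) ->
  in_ideal lam p.
Proof.
move=> kp H; have [/laur3P lp ip] := kp; apply: vanishing_in_ideal => // w z h hz hh.
have pJ := Jof_part Hn w.
rewrite -(@restr_perm_eq p (Jof Hn w)) //; last by move=> i; rewrite ffunE permK.
apply: (@laur2_generic_domE (restr lam p (Jof Hn w)) (fun _ _ => 0)) => //.
- exact: laur2_restr.
- exact: laur_cst.
- exact: H.
Qed.
End Geometry.

(** * Terms of the weight functions *)

Section EnumPerm.
Variables (n : nat) (P : pred 'I_n).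

Let sq := filter P (enum 'I_n) ++ filter (predC P) (enum 'I_n).

Let sq_perm : perm_eq sq (enum 'I_n). Proof. exact/permPl/perm_filterC. Qed.

Let sq_size : size sq = n. Proof. by rewrite (perm_size sq_perm) size_enum_ord. Qed.

Lemma eperm_inj : injective (fun a : 'I_n => nth a sq a).
Proof.
move=> a b; rewrite (set_nth_default b) ?sq_size // => /eqP.
by rewrite nth_uniq ?sq_size // ?(perm_uniq sq_perm) ?enum_uniq // => /eqP/val_inj.
Qed.

(* Lists the elements of [P] in increasing order, then the others. *)
Definition eperm : 'S_n := perm eperm_inj.

Let sizeP : size (filter P (enum 'I_n)) = #|P|.
Proof. by rewrite cardE enumT. Qed.

Lemma eperm_nth T (x0 : T) (g : 'I_n -> T) (a : 'I_n) : (a < #|P|)%N ->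
  nth x0 [seq g x | x <- enum 'I_n & P x] a = g (eperm a).
Proof. by move=> ha; rewrite (nth_map a) ?sizeP // permE /sq nth_cat sizeP ha. Qed.

Lemma eperm_mem (a : 'I_n) : (a < #|P|)%N = P (eperm a).
Proof.
rewrite permE /sq nth_cat sizeP; case: ltnP => ha.
  have : nth a [seq x <- enum 'I_n | P x] a \in [seq x <- enum 'I_n | P x] by rewrite mem_nth ?sizeP.
  by rewrite mem_filter => /andP[-> _].
have : nth a [seq x <- enum 'I_n | predC P x] (a - #|P|) \in [seq x <- enum 'I_n | predC P x].
  apply: mem_nth; rewrite ltn_subLR // -sizeP -size_cat.
  by rewrite [X in (_ < X)%N]sq_size.
by rewrite mem_filter => /andP[/negbTE -> _].
Qed.

Lemma eperm_ltn (a b : 'I_n) : (a < #|P|)%N -> (b < #|P|)%N ->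
  (eperm a < eperm b)%N = (a < b)%N.
Proof.
have st : sorted ltn [seq nat_of_ord x | x <- enum 'I_n & P x].
  rewrite sorted_map; apply: sorted_filter.
    by move=> x y w /=; exact: ltn_trans.
  by rewrite -sorted_map val_enum_ord iota_ltn_sorted.
have lt (c d : 'I_n) : (c < #|P|)%N -> (d < #|P|)%N -> (c < d)%N -> (eperm c < eperm d)%N.
  move=> hc hd cd; rewrite -!(eperm_nth 0%N (@nat_of_ord n)) //.
  by apply: (sorted_ltn_nth ltn_trans 0%N st) => //; rewrite inE size_map sizeP.
move=> ha hb; case: (ltngtP a b) => [h|h|/val_inj ->]; last by rewrite ltnn.
  by rewrite lt.
by apply/negbTE; rewrite -leqNgt ltnW // lt.
Qed.

Lemma eperm_all : (forall x, P x) -> eperm = 1%g.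
Proof.
move=> H; apply/permP => a; rewrite perm1; apply: val_inj => /=.
have c : #|P| = n by rewrite -[RHS]card_ord; apply: eq_card => x; rewrite !inE; exact: H.
rewrite -(eperm_nth 0%N (@nat_of_ord n)) ?c //.
by rewrite (eq_filter (a2 := predT)) // filter_predT val_enum_ord nth_iota.
Qed.
End EnumPerm.

(** * Symmetrisation terms as families of bijections *)

Section Clean.
Variables (F : numClosedFieldType) (N n : nat) (lam : 'I_N -> nat).
Hypothesis Hn : (\sum_(k < N) lam k)%N = n.
Variable B : 'I_n -> 'I_N.
Hypothesis HB : forall k : 'I_N, #|[pred x | B x == k]| = lam k.
Implicit Types (J : 'I_n -> 'I_N) (z : 'I_n -> F) (h : F).

Lemma card_lvl J k : (forall k : 'I_N, #|[pred x | J x == k]| = lam k) ->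
  #|[pred x | (J x <= k)%N]| = Lsum lam k.
Proof.
move=> HJ; rewrite -sum1_card (partition_big J (fun j : 'I_N => (j <= k)%N)) //=.
apply: eq_bigr => j jk; rewrite -HJ -sum1_card; apply: eq_bigl => x.
by rewrite !inE; case: eqP => [->|]; rewrite ?jk ?andbF.
Qed.

Definition bet (k : nat) : 'S_n := eperm [pred u | (B u <= k)%N].

Lemma le_last J x : (J x <= N.-1)%N.
Proof. by rewrite -ltnS (leq_trans (ltn_ord _)) ?leqSpred. Qed.

Lemma bet_last : bet N.-1 = 1%g.
Proof. by apply: eperm_all => x; exact: le_last. Qed.

Lemma bet_mem k (a : 'I_n) : (a < Lsum lam k)%N = (B (bet k a) <= k)%N.
Proof. by rewrite -(card_lvl k HB) (eperm_mem [pred u | (B u <= k)%N]). Qed.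

Lemma iota_bet k (a : 'I_n) : (a < Lsum lam k)%N -> iota_ B k a = bet k a.
Proof.
rewrite -(card_lvl k HB) => ha; rewrite /iota_ /ords.
by rewrite (eperm_nth (P := [pred u | (B u <= k)%N]) 0%N (@nat_of_ord n)).
Qed.

Lemma bet_ltn k (a b : 'I_n) : (a < Lsum lam k)%N -> (b < Lsum lam k)%N ->
  (bet k a < bet k b)%N = (a < b)%N.
Proof. rewrite -(card_lvl k HB); exact: eperm_ltn. Qed.

(** [U] after the substitution, each variable of level [k] being named by the [x] whose [z x] it
    takes; [Q k x] is then the index that [U] compares. The order of positions becomes the order of
    the [Q k x], as [bet] is increasing. *)
Definition Ucl J (Q : nat -> 'S_n) z h : F :=
  \prod_(k < N.-1) \prod_(x | (J x <= k)%N)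
   ((\prod_(y | (J y <= k.+1)%N && (Q k.+1 y < Q k x)%N) (1 - h * z y / z x)) *
    (\prod_(y | (J y <= k.+1)%N && (Q k x < Q k.+1 y)%N) (1 - z y / z x)) *
    (\prod_(y | (J y <= k)%N && (Q k x < Q k y)%N)
        ((1 - h * z y / z x) / (1 - z y / z x)))).

Lemma prod_lvl (pi : 'S_n) (m : nat) (L : pred 'I_n) (P : pred nat) (G : nat -> F) :
  (m <= n)%N -> (forall a : 'I_n, (a < m)%N = L (pi a)) ->
  \prod_(c < m | P c) G c = \prod_(y | L y && P ((pi^-1)%g y)) G ((pi^-1)%g y).
Proof.
move=> mn H; rewrite (big_ord_widen_cond n P G mn).
rewrite (reindex_inj (@perm_inj _ (pi^-1)%g)) /=; apply: eq_bigl => y.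
by rewrite H permKV andbC.
Qed.

Definition lvlperm J (pi : nat -> 'S_n) :=
  forall k, (k <= N.-1)%N -> forall a : 'I_n, (a < Lsum lam k)%N = (J (pi k a) <= k)%N.

Definition Ufac (t : nat -> nat -> F) h (k a : nat) : F :=
    ((\prod_(c < Lsum lam k.+1 | (iota_ B k.+1 c < iota_ B k a)%N)
         (1 - h * t k.+1 c / t k a)) *
     (\prod_(c < Lsum lam k.+1 | (iota_ B k a < iota_ B k.+1 c)%N)
         (1 - t k.+1 c / t k a)) *
     (\prod_(a.+1 <= b < Lsum lam k)
         ((1 - h * t k b / t k a) / (1 - t k b / t k a)))).

Lemma Uval_clean J (pi : nat -> 'S_n) (t : nat -> nat -> F) z h :
  lvlperm J pi ->
  (forall k, (k <= N.-1)%N -> forall a : 'I_n, (a < Lsum lam k)%N -> t k a = z (pi k a)) ->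
  Uval lam B t h = Ucl J (fun k => ((pi k)^-1 * bet k)%g) z h.
Proof.
move=> Hpi Ht; apply: eq_bigr => k _.
have k1 : (k <= N.-1)%N by exact: ltnW.
have k2 : (k.+1 <= N.-1)%N by exact: ltn_ord.
rewrite (_ : \prod_(a < _) _ = \prod_(a < Lsum lam k | xpredT a) Ufac t h k a) //.
rewrite (prod_lvl (pi := pi k) (L := fun x => (J x <= k)%N) xpredT (Ufac t h k)) ?Lsum_le //; last exact: Hpi.
apply: eq_big => [x|x]; rewrite andbT // => Jx.
have hx : ((pi k)^-1%g x < Lsum lam k)%N by rewrite Hpi // permKV.
have tx : t k ((pi k)^-1%g x) = z x by rewrite Ht // permKV.
have Qx : iota_ B k ((pi k)^-1%g x) = ((pi k)^-1 * bet k)%g x by rewrite iota_bet // permM.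
rewrite /Ufac; congr (_ * _ * _).
- rewrite (prod_lvl (pi := pi k.+1) (L := fun x => (J x <= k.+1)%N)
      (fun c => (iota_ B k.+1 c < iota_ B k ((pi k)^-1%g x))%N)
      (fun c => 1 - h * t k.+1 c / t k ((pi k)^-1%g x))) ?Lsum_le //; last exact: Hpi.
  apply: eq_big => [y|y /andP[Jy _]]; last by rewrite tx Ht ?permKV // Hpi // permKV.
  by apply: andb_id2l => Jy; rewrite Qx iota_bet ?permM // Hpi // permKV.
- rewrite (prod_lvl (pi := pi k.+1) (L := fun x => (J x <= k.+1)%N)
      (fun c => (iota_ B k ((pi k)^-1%g x) < iota_ B k.+1 c)%N)
      (fun c => 1 - t k.+1 c / t k ((pi k)^-1%g x))) ?Lsum_le //; last exact: Hpi.
  apply: eq_big => [y|y /andP[Jy _]]; last by rewrite tx Ht ?permKV // Hpi // permKV.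
  by apply: andb_id2l => Jy; rewrite Qx iota_bet ?permM // Hpi // permKV.
rewrite big_geq_mkord.
rewrite (prod_lvl (pi := pi k) (L := fun x => (J x <= k)%N)
      (fun c => ((pi k)^-1%g x < c)%N)
      (fun b => (1 - h * t k b / t k ((pi k)^-1%g x)) / (1 - t k b / t k ((pi k)^-1%g x))))
   ?Lsum_le //; last exact: Hpi.
apply: eq_big => [y|y /andP[Jy _]]; last by rewrite tx Ht ?permKV // Hpi // permKV.
by apply: andb_id2l => Jy; rewrite !permM bet_ltn // Hpi // permKV.
Qed.

(** [E] without its diagonal factors: these all equal [1 - h] and cancel the power of [1 - h] in
    [W]. *)
Definition Ered J z h : F :=
  \prod_(k < N.-1) \prod_(x | (J x <= k)%N) \prod_(y | (J y <= k)%N && (y != x))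
    (1 - h * z y / z x).

Lemma Eval_clean J (pi : nat -> 'S_n) (t : nat -> nat -> F) z h :
  torus z -> (forall k : 'I_N, #|[pred x | J x == k]| = lam k) -> lvlperm J pi ->
  (forall k, (k <= N.-1)%N -> forall a : 'I_n, (a < Lsum lam k)%N -> t k a = z (pi k a)) ->
  Eval lam t h = (1 - h) ^+ lam1 lam * Ered J z h.
Proof.
move=> hz HJ Hpi Ht; rewrite /lam1 -prodrXr /Ered -big_split; apply: eq_bigr => k _ /=.
have k1 : (k <= N.-1)%N by exact: ltnW.
rewrite -[in RHS](card_lvl k HJ) -prodr_const -big_split /=.
rewrite (prod_lvl (pi := pi k) (L := fun x => (J x <= k)%N) xpredT
   (fun a => \prod_(b < Lsum lam k) (1 - h * t k b / t k a))) ?Lsum_le //; last exact: Hpi.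
apply: eq_big => [x|x]; rewrite andbT // => Jx.
have tx : t k ((pi k)^-1%g x) = z x by rewrite Ht ?permKV // Hpi // permKV.
rewrite (prod_lvl (pi := pi k) (L := fun x => (J x <= k)%N) xpredT
   (fun b => (1 - h * t k b / t k ((pi k)^-1%g x)))) ?Lsum_le //; last exact: Hpi.
rewrite (bigD1 x) ?andbT //=; congr (_ * _); first by rewrite tx mulfK ?hz.
apply: eq_big => [y|y]; rewrite andbT // => /andP[Jy _].
by rewrite tx Ht ?permKV // Hpi // permKV.
Qed.

Section Sums.
Implicit Type s : {ffun 'I_N -> {perm 'I_n}}.

Definition sat s (k : nat) : 'S_n := if insub k is Some k' then s k' else 1%g.

Lemma admP s : reflect (forall (k : 'I_N) (i : 'I_n), s k i != i -> (i < Lsum lam k)%N && (k < N.-1)%N)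
  (adm lam s).
Proof.
apply: (iffP forallP) => [H k i h|H k]; first by have /forallP/(_ i)/implyP/(_ h) := H k.
by apply/forallP => i; apply/implyP; exact: H.
Qed.

Lemma sat_lt s k (a : 'I_n) : adm lam s -> (sat s k a < Lsum lam k)%N = (a < Lsum lam k)%N.
Proof.
move=> /admP H; rewrite /sat; case: insubP => [k' _ <-|_]; last by rewrite perm1.
have [->//|ne] := eqVneq (s k' a) a.
have /andP[-> _] := H k' a ne.
by have /andP[] := H k' (s k' a) (contra_neq (@perm_inj _ (s k') _ _) ne).
Qed.

Lemma sat_last s : adm lam s -> sat s N.-1 = 1%g.
Proof.
move=> /admP H; rewrite /sat; case: insubP => [k' _ Ek|//].
apply/permP => i; rewrite perm1; apply/eqP/negPn/negP => /H; rewrite -Ek ltnn andbF; by [].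
Qed.

Definition Qof (Y : nat -> 'S_n) s (k : nat) : 'S_n := ((sat s k * Y k)^-1 * bet k)%g.

Definition SU J Y z h : F := \sum_(s : {ffun 'I_N -> {perm 'I_n}} | adm lam s) Ucl J (Qof Y s) z h.

Lemma lvlperm_sat J Y s : adm lam s -> lvlperm J Y -> lvlperm J (fun k => (sat s k * Y k)%g).
Proof. by move=> hs H k hk a; rewrite permM -H // sat_lt. Qed.

Lemma permt_sat s (t : nat -> nat -> F) (k : nat) (a : 'I_n) :
  permt s t k a = t k (sat s k a).
Proof.
rewrite /permt /sat; case: insubP => [k' _ _|_]; last by rewrite perm1.
by rewrite /permn insubT //= => h; congr (t k (s k' _)); apply: val_inj.
Qed.

Lemma sum_Uval J Y (t : nat -> nat -> F) z h : lvlperm J Y ->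
  (forall k, (k <= N.-1)%N -> forall a : 'I_n, (a < Lsum lam k)%N -> t k a = z (Y k a)) ->
  \sum_(s : {ffun 'I_N -> {perm 'I_n}} | adm lam s) Uval lam B (permt s t) h = SU J Y z h.
Proof.
move=> HY Ht; apply: eq_bigr => s hs.
rewrite (@Uval_clean J (fun k => (sat s k * Y k)%g) _ z) //; first exact: lvlperm_sat.
by move=> k hk a ha; rewrite permt_sat Ht ?sat_lt // permM.
Qed.

(** Symmetrisation absorbs the choice of labelling below the top level, where only the set of values
    matters. *)
Lemma SU_indep J Y Y' z h : lvlperm J Y -> lvlperm J Y' -> Y N.-1 = Y' N.-1 ->
  SU J Y z h = SU J Y' z h.
Proof.
move=> HY HY' E.
(* [f] is [Y^-1 o Y'] on the symmetrised variables and the identity elsewhere, hence gives an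
   admissible family; composing with it permutes the admissible families. *)
pose f k (a : 'I_n) := if (a < Lsum lam k)%N && (k < N.-1)%N then ((Y k)^-1)%g (Y' k a) else a.
have fl k a : (k < N.-1)%N -> (f k a < Lsum lam k)%N = (a < Lsum lam k)%N.
  move=> hk; rewrite /f hk andbT; case: ifP => // ha.
  by rewrite (HY k (ltnW hk)) permKV -(HY' k (ltnW hk)) ha.
have fi k : injective (f k).
  case: (ltnP k N.-1) => hk; last by move=> a b; rewrite /f [(k < N.-1)%N]ltnNge hk !andbF.
  move=> a b Eab; have := fl k a hk; rewrite Eab fl // => El.
  by move: Eab; rewrite /f hk !andbT -El; case: ifP => // _ /perm_inj/perm_inj.
pose r : {ffun 'I_N -> {perm 'I_n}} := [ffun k : 'I_N => perm (fi k)].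
have ar : adm lam r.
  apply/admP => k i; rewrite ffunE permE /f; case: ifP => //; by rewrite eqxx.
pose t k a : F := if insub a is Some a' then z (Y' k a') else 1.
have tE k (a : 'I_n) : t k a = z (Y' k a) by rewrite /t valK.
have rE k (a : 'I_n) : (k <= N.-1)%N -> (a < Lsum lam k)%N -> Y k (sat r k a) = Y' k a.
  move=> hk ha; have hN : (0 < N)%N.
    case: N B => // B0; by case: (B0 a).
  have hk' : (k < N)%N by lia.
  rewrite /sat insubT /= ffunE permE /f /= ha /=; case: ltnP => hk2; first by rewrite permKV.
  have -> : k = N.-1 by lia.
  by rewrite E.
rewrite -[RHS](@sum_Uval J Y' t) //.
pose m s : {ffun 'I_N -> {perm 'I_n}} := [ffun k => (s k * r k)%g].
have mi : injective m.
  by move=> s1 s2 Em; apply/ffunP => k; have := congr1 (fun g : {ffun 'I_N -> {perm 'I_n}} => g k) Em;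
     rewrite !ffunE => /mulIg.
have satm s k : sat (m s) k = (sat s k * sat r k)%g.
  by rewrite /sat; case: insubP => [k' _ _|_]; rewrite ?ffunE ?mulg1.
have am s : adm lam s -> adm lam (m s).
  move=> hs; apply/admP => k i; rewrite ffunE permM => ne.
  move/admP: hs => hs; move/admP: ar => ar'.
  have [Es|] := eqVneq (s k i) i; last exact: hs.
  by rewrite Es in ne; exact: ar'.
rewrite /SU (reindex_inj mi) /= (eq_bigl (adm lam)); last first.
  move=> s; apply/idP/idP => [h1|]; last exact: am.
  apply/admP => k i ne; move/admP: h1 => h1; move/admP: ar => ar'.
  case: (boolP ((i < Lsum lam k)%N && (k < N.-1)%N)) => // out.
  have r1 (j : 'I_n) : ~~ ((j < Lsum lam k)%N && (k < N.-1)%N) -> r k j = j.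
    by move=> hj; apply/eqP/negPn/negP => /ar'; rewrite (negbTE hj).
  have [Em|/h1 //] := eqVneq (m s k i) i; last by rewrite (negbTE out).
  move: ne; rewrite -(inj_eq (@perm_inj _ (r k))) (r1 i out) -permM.
  by move: Em; rewrite ffunE => ->; rewrite eqxx.
apply: eq_bigr => s hs.
rewrite [RHS](@Uval_clean J (fun k => (sat (m s) k * Y k)%g) (permt s t) z) //.
- by apply: lvlperm_sat => //; exact: am.
- move=> k hk a ha; rewrite permt_sat tE !permM satm permM rE // sat_lt //.
Qed.

End Sums.
End Clean.

(** * Weight functions are Laurent polynomials *)

Section WeightLaurent.
Variables (F : numClosedFieldType) (N n : nat) (lam : 'I_N -> nat).
Hypothesis Hn : (\sum_(k < N) lam k)%N = n.
Variable B : 'I_n -> 'I_N.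
Let X := ('I_N * 'I_n + unit)%type.
Implicit Types (x : X -> F) (s : {ffun 'I_N -> {perm 'I_n}}).

Definition tx x (k a : nat) : F :=
  match insub k, insub a with
  | Some k', Some a' => x (inl (k', a'))
  | _, _ => 1
  end.

Definition xperm s x : X -> F := fun v => match v with
  | inl (k, a) => x (inl (k, s k a)) | inr u => x (inr u) end.

Lemma txE x (k : 'I_N) (a : 'I_n) : tx x k a = x (inl (k, a)).
Proof. by rewrite /tx !valK. Qed.

Lemma tx_neq0 x k a : tor x -> tx x k a != 0.
Proof. by move=> hx; rewrite /tx; case: (insub k : option 'I_N) => [?|]; case: (insub a : option 'I_n) => [?|]; rewrite ?oner_neq0. Qed.

Lemma laur_tx k a : laur (fun x => tx x k a).
Proof. by rewrite /tx; case: (insub k : option 'I_N) => [?|]; case: (insub a : option 'I_n) => [?|]; first [exact: laur_var | exact: laur_cst]. Qed.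

Lemma laur_txV k a : laur (fun x => (tx x k a)^-1).
Proof. by rewrite /tx; case: (insub k : option 'I_N) => [?|]; case: (insub a : option 'I_n) => [?|]; first [exact: laur_varV | exact: laur_cst]. Qed.

Lemma permt_tx s x : permt s (tx x) = tx (xperm s x).
Proof.
apply: functional_extensionality => k; apply: functional_extensionality => a.
rewrite /permt /tx /permn; case: insubP => [k' _ _|//].
by case E: (insub a) => [a'|]; rewrite ?valK ?E.
Qed.

Lemma tor_xperm s x : tor x -> tor (xperm s x).
Proof. by move=> hx [[k a]|u] /=. Qed.

(** All [n] variables of a level enter, so that [vand_perm] gives the sign of a permutation; [rest]
    collects the factors whose larger index is not below [Lsum lam k]. *)
Definition vd x : F := \prod_(k < N | (k < N.-1)%N) vand (fun a => x (inl (k, a))).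

Definition rest x : F := \prod_(k < N | (k < N.-1)%N) \prod_(a < n)
  \prod_(b < n | (a < b)%N && ~~ (b < Lsum lam k)%N) (x (inl (k, b)) - x (inl (k, a))).

(** Denominators cleared: [t_b - t_a] divided by [1 - t_b / t_a] is [- t_a]. *)
Definition unum x : F :=
  \prod_(k < N.-1) \prod_(a < Lsum lam k)
    ((\prod_(c < Lsum lam k.+1 | (iota_ B k.+1 c < iota_ B k a)%N)
         (1 - x (inr tt) * tx x k.+1 c / tx x k a)) *
     (\prod_(c < Lsum lam k.+1 | (iota_ B k a < iota_ B k.+1 c)%N)
         (1 - tx x k.+1 c / tx x k a)) *
     (\prod_(a.+1 <= b < Lsum lam k)
         ((1 - x (inr tt) * tx x k b / tx x k a) * - tx x k a))).

Lemma prod_lt_widen (m : nat) (G : nat -> nat -> F) : (m <= n)%N ->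
  \prod_(a < m) \prod_(a.+1 <= b < m) G a b =
  \prod_(a < n) \prod_(b < n | (a < b)%N && (b < m)%N) G a b.
Proof.
move=> mn; rewrite (big_ord_widen n (fun a => \prod_(a.+1 <= b < m) G a b) mn).
rewrite big_mkcond; apply: eq_bigr => a _; case: ifP => ha.
  by rewrite big_geq_mkord (big_ord_widen_cond n (fun b => (a < b)%N) (G a)).
by rewrite big_pred0 // => b; lia.
Qed.

Lemma unum_eq x : tor x -> (forall k, injective (fun a => x (inl (k, a)))) ->
  Uval lam B (tx x) (x (inr tt)) * vd x = unum x * rest x.
Proof.
move=> hx xi.
have -> : vd x = (\prod_(k < N.-1) \prod_(a < Lsum lam k) \prod_(a.+1 <= b < Lsum lam k)
    (tx x k b - tx x k a)) * rest x.
  rewrite (big_ord_widen N (fun k => \prod_(a < Lsum lam k) \prod_(a.+1 <= b < Lsum lam k)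
    (tx x k b - tx x k a)) (leq_pred N)).
  rewrite /vd /rest -big_split; apply: eq_bigr => k _ /=.
  rewrite (prod_lt_widen (fun a b => tx x k b - tx x k a)) ?Lsum_le //.
  rewrite /vand -big_split; apply: eq_bigr => a _ /=.
  rewrite (bigID (fun b : 'I_n => (b < Lsum lam k)%N)) /=; congr (_ * _).
  by apply: eq_bigr => b _; rewrite !txE.
rewrite mulrA; congr (_ * _); rewrite /Uval /unum -big_split; apply: eq_bigr => k _ /=.
rewrite -big_split; apply: eq_bigr => a _ /=; rewrite -(mulrA (_ * _)); congr (_ * _).
rewrite -big_split; apply: eq_big_nat => b /andP[ab bm] /=.
have kN : (k < N)%N by have := ltn_ord k; lia.
have bn : (b < n)%N by apply: leq_trans bm _; exact: Lsum_le.
have an : (a < n)%N by apply: ltn_trans ab bn.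
have := tx_neq0 k a hx.
have : tx x k a - tx x k b != 0.
  rewrite -[nat_of_ord k]/(nat_of_ord (Ordinal kN)) -[b]/(nat_of_ord (Ordinal bn)).
  rewrite -[nat_of_ord a]/(nat_of_ord (Ordinal an)) !txE subr_eq0.
  by apply: contraTneq ab => /xi[] ->; rewrite ltnn.
move: (tx x k a) (tx x k b) (x (inr tt)) => ta tb h d0 a0.
by field; rewrite d0 a0.
Qed.

Lemma laur_unum : laur unum.
Proof.
rewrite /unum; repeat first
  [ exact: laur_cst | exact: laur_var | exact: laur_tx | exact: laur_txV
  | apply: laur_add | apply: laur_opp | apply: laur_mul
  | (apply: laur_prod => ? ?) ].
Qed.

Lemma laur_rest : laur rest.
Proof. rewrite /rest; laur_tac. Qed.

Definition esg s : F := \prod_(k < N | (k < N.-1)%N) (-1) ^+ (s k).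

Lemma vd_perm s x : vd (xperm s x) = esg s * vd x.
Proof.
by rewrite /esg -big_split; apply: eq_bigr => k _; rewrite -[RHS](vand_perm (fun a => x (inl (k, a)))).
Qed.

Lemma esg_sq s : esg s * esg s = 1.
Proof.
rewrite /esg -big_split big1 // => k _ /=.
by rewrite -signr_addb addbb.
Qed.

Lemma laur_xperm s f : laur f -> laur (fun x => f (xperm s x)).
Proof.
move=> lf; apply: (laur_eq (laur_subst (g := fun v x => xperm s x v) lf _)) => //.
by case=> [[k a]|u]; exact: ulaur_var.
Qed.

Definition altU x : F := \sum_(s : {ffun 'I_N -> {perm 'I_n}} | adm lam s)
  esg s * (unum (xperm s x) * rest (xperm s x)).

Lemma altU0 (k : 'I_N) (a b : 'I_n) x : tor x -> (k < N.-1)%N -> (a < b)%N ->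
  x (inl (k, b)) = x (inl (k, a)) -> altU x = 0.
Proof.
(* If [b] is outside the symmetrised range, every [s] fixes it and keeps the preimage of [a] below
   it, so [rest] has a vanishing factor in each term. Otherwise [tperm a b] pairs terms of opposite
   sign. *)
move=> hx kN ab E; case: (ltnP b (Lsum lam k)) => hb; last first.
  rewrite /altU big1 // => s /admP hs; suff -> : rest (xperm s x) = 0 by rewrite !mulr0.
  have fixs (c : 'I_n) : (Lsum lam k <= c)%N -> s k c = c.
    by move=> hc; apply/eqP/negPn/negP => /hs; rewrite ltnNge hc.
  have hab : ((s k)^-1%g a < b)%N.
    rewrite ltnNge; apply/negP => h.
    have := fixs _ (leq_trans hb h); rewrite permKV => Ea; move: h; rewrite -Ea; lia.
  rewrite /rest (bigD1 k) //= (bigD1 ((s k)^-1%g a)) //= (bigD1 b) /=; last by rewrite hab -leqNgt.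
  by rewrite permKV fixs // E subrr !mul0r.
have ne : a != b by apply: contraTneq ab => ->; rewrite ltnn.
pose m s : {ffun 'I_N -> {perm 'I_n}} :=
  [ffun l => if l == k then (s l * tperm a b)%g else s l].
have mm s : m (m s) = s.
  by apply/ffunP => l; rewrite !ffunE; case: (l =P k) => // _; rewrite -mulgA tperm2 mulg1.
have mi : injective m by exact: can_inj mm.
have am s : adm lam s -> adm lam (m s).
  move=> /admP hs; apply/admP => l i; rewrite ffunE; case: (l =P k) => [->|_]; last exact: hs.
  rewrite permM => h; have [Es|] := eqVneq (s k i) i; last exact: hs.
  rewrite kN andbT; move: h; rewrite Es; case: tpermP => [->|->|]; rewrite ?eqxx // => _.
  exact: ltn_trans ab hb.
have : altU x = - altU x.
  rewrite {1}/altU (reindex_inj mi) /= -sumrN; apply: eq_big => [s|s _].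
    by apply/idP/idP => [/am|]; [rewrite mm | exact: am].
  have -> : xperm (m s) x = xperm s x.
    apply: functional_extensionality => -[[l i]|//] /=; rewrite ffunE; case: (l =P k) => // ->.
    by rewrite permM; case: tpermP => [->|->|].
  have -> : esg (m s) = - esg s.
    rewrite /esg (bigD1 k) //= [in RHS](bigD1 k) //= ffunE eqxx signMtperm // mulNr.
    by congr (- (_ * _)); apply: eq_bigr => l /andP[_ /negbTE hl]; rewrite ffunE hl.
  by rewrite mulNr.
by move/eqP; rewrite -addr_eq0 -mulr2n mulrn_eq0 => /eqP.
Qed.

(** Single terms have poles at [t_a = t_b]; multiplied by [vd], their sum alternates in each level,
    so [vd] divides it and the poles cancel. *)
Lemma sumU_laurent : exists2 G : (X -> F) -> F, laur G & forall x, tor x ->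
  (forall k, injective (fun a => x (inl (k, a)))) ->
  G x = \sum_(s : {ffun 'I_N -> {perm 'I_n}} | adm lam s) Uval lam B (permt s (tx x)) (x (inr tt)).
Proof.
have lA : laur altU.
  apply: laur_sum => s _; apply: laur_mul; first exact: laur_cst.
  by apply: laur_mul; apply: laur_xperm; [exact: laur_unum | exact: laur_rest].
pose L := enum [pred p : 'I_N * ('I_n * 'I_n) | (p.1 < N.-1)%N && (p.2.1 < p.2.2)%N].
have HL p : (p \in L) = (p.1 < N.-1)%N && (p.2.1 < p.2.2)%N by rewrite mem_enum inE.
have [|||G lG HG] := @laur_div_pairs F X _ (fun p => inl (p.1, p.2.1)) (fun p => inl (p.1, p.2.2))
   L altU (enum_uniq _) _ _ lA.
- by move=> p; rewrite HL => /andP[_ hp]; apply: contraTneq hp => -[->]; rewrite ltnn.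
- move=> [k [a b]] [k' [a' b']]; rewrite !HL /= => /andP[_ ij] /andP[_ kl] ne.
  apply/andP; split; apply/negP => /andP[/eqP[E1 E2] /eqP[_ E3]].
    by move: ne; rewrite E1 E2 E3 eqxx.
  by move: ij; rewrite E2 E3 ltnNge ltnW.
- by move=> p; rewrite HL => /andP[h1 h2] x hx E; exact: (altU0 hx h1 h2).
exists G => // x hx xi.
have vE : \prod_(p <- L) (x (inl (p.1, p.2.2)) - x (inl (p.1, p.2.1))) = vd x.
  rewrite /L big_enum /vd /vand /=.
  under [RHS]eq_bigr do rewrite pair_big_dep.
  by rewrite pair_big_dep.
have v0 : vd x != 0 by apply/prodf_neq0 => k _; exact: vand_neq0.
apply: (mulfI v0); rewrite -{1}vE -HG // /altU mulr_sumr; apply: eq_bigr => s _.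
rewrite permt_tx -unum_eq //; first last.
- by move=> k a b /= /xi/perm_inj.
- exact: tor_xperm.
by rewrite vd_perm [X in esg s * X]mulrCA (mulrA (esg s) (esg s)) esg_sq mul1r mulrC.
Qed.

End WeightLaurent.

(** * Weight functions at a fixed point *)

Section Wt.
Variables (F : numClosedFieldType) (N n : nat) (lam : 'I_N -> nat).
Hypothesis Hn : (\sum_(k < N) lam k)%N = n.
Variables (sigma : 'S_n) (I : {ffun 'I_n -> 'I_N}).
Hypothesis HI : is_part lam I.
Let B : 'I_n -> 'I_N := fun x => I (sigma x).
Implicit Types (J : {ffun 'I_n -> 'I_N}) (z : 'I_n -> F) (h : F) (Y : nat -> 'S_n).

Lemma part_comp : forall k : 'I_N, #|[pred x | B x == k]| = lam k.
Proof.
move=> k; rewrite -HI -[RHS](card_image (@perm_inj _ (sigma^-1)%g)); apply: eq_card => x.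
rewrite [LHS]inE; apply/idP/imageP => [h|[i h ->]].
  by exists (sigma x); rewrite ?permK // inE.
by rewrite /B permKV.
Qed.

(** The labelling behind the substitution [t = z_J]; its top level is [sigma] because [W_(sigma,I)]
    takes the [z] permuted by [sigma]. *)
Definition Ycan J (k : nat) : 'S_n :=
  if (k < N.-1)%N then eperm [pred x | (J x <= k)%N] else sigma.

Lemma lvlperm_last J Y : Y N.-1 = sigma ->
  (forall k, (k < N.-1)%N -> forall a : 'I_n, (a < Lsum lam k)%N = (J (Y k a) <= k)%N) ->
  lvlperm lam J Y.
Proof.
move=> E H k hk a; case: (ltnP k N.-1) => hk'; first exact: H.
have -> : k = N.-1 by lia.
by rewrite (Lsum_last Hn) ltn_ord le_last.
Qed.

Lemma Ycan_last J : Ycan J N.-1 = sigma.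
Proof. by rewrite /Ycan ltnn. Qed.

Lemma lvlperm_Ycan J : is_part lam J -> lvlperm lam J (Ycan J).
Proof.
move=> pJ; apply: lvlperm_last => [|k hk a]; first exact: Ycan_last.
by rewrite /Ycan hk -(card_lvl k pJ) (eperm_mem [pred x | (J x <= k)%N]).
Qed.

Lemma tJ_Ycan J z k (a : 'I_n) : is_part lam J -> (a < Lsum lam k)%N ->
  tJ sigma J z k a = z (Ycan J k a).
Proof.
move=> pJ ha; rewrite /tJ /Ycan; case: ifP => hk.
  by rewrite (eperm_nth (P := [pred x | (J x <= k)%N])) // (card_lvl k pJ).
by rewrite (nth_map a) ?size_enum_ord // nth_ord_enum.
Qed.

Lemma Wt_SU J Y z h : is_part lam J -> lvlperm lam J Y -> Y N.-1 = sigma -> generic z h ->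
  Wt lam sigma I J z h = SU lam B J Y z h / Ered J z h.
Proof.
move=> pJ hY Yl [hz zi hh h1 zh].
have hY' := lvlperm_Ycan pJ.
have ht k : (k <= N.-1)%N -> forall a : 'I_n, (a < Lsum lam k)%N -> tJ sigma J z k a = z (Ycan J k a).
  by move=> _ a ha; exact: tJ_Ycan.
rewrite /Wt /Wfun (Eval_clean Hn h hz pJ hY' ht) (sum_Uval Hn part_comp h hY' ht).
rewrite (SU_indep Hn part_comp z h hY' hY) ?Ycan_last //.
rewrite invfM mulrACA divff ?mul1r //.
by rewrite expf_neq0 // subr_eq0 eq_sym.
Qed.

Definition xY Y z h : ('I_N * 'I_n + unit) -> F := fun v => match v with
  | inl (k, a) => z (Y k a) | inr _ => h end.

(** One [G] serves all [J]: the fixed point enters only through the substituted values, which makes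
    different fixed points comparable. *)
Lemma SU_laurent : exists2 G : ('I_N * 'I_n + unit -> F) -> F, laur G &
  forall J Y z h, lvlperm lam J Y -> torus z -> h != 0 -> injective z ->
    G (xY Y z h) = SU lam B J Y z h.
Proof.
have [G lG HG] := sumU_laurent F Hn B; exists G => // J Y z h hY hz hh zi.
rewrite HG //; first last.
- by move=> k a b /= /zi/perm_inj.
- by case=> [[k a]|u] //=; exact: hz.
apply: (sum_Uval Hn part_comp) => // k hk a ha.
have kN : (k < N)%N by have := ltn_ord (B a); lia.
by rewrite -[k]/(nat_of_ord (Ordinal kN)) txE.
Qed.

Lemma laur2_xY (G : ('I_N * 'I_n + unit -> F) -> F) Y : laur G -> laur2 (fun z h => G (xY Y z h)).
Proof.
move=> lG; apply: (laur_eq (laur_subst (g := fun v (x : 'I_n + unit -> F) =>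
   xY Y (fun i => x (inl i)) (x (inr tt)) v) lG _)) => //.
by case=> [[k a]|u]; exact: ulaur_var.
Qed.
End Wt.

(** * Divisibility *)

Section Families.
Variables (F : numClosedFieldType) (N n : nat) (B : 'I_n -> 'I_N) (sigma : 'S_n).
Implicit Types (J : 'I_n -> 'I_N) (Q : nat -> 'S_n) (z : 'I_n -> F) (h : F).

Definition good J Q :=
  (forall k, (k <= N.-1)%N -> forall x, (B (Q k x) <= k)%N = (J x <= k)%N) /\
  Q N.-1 = (sigma^-1)%g.

Lemma good_Qof (lam : 'I_N -> nat) J Y s :
  (\sum_(k < N) lam k)%N = n -> (forall k : 'I_N, #|[pred x | B x == k]| = lam k) ->
  lvlperm lam J Y -> Y N.-1 = sigma -> adm lam s -> good J (Qof B Y s).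
Proof.
move=> Hn HB hY Yl hs; split=> [k hk x|].
  rewrite /Qof permM -(bet_mem HB).
  by rewrite (lvlperm_sat hs hY) // permKV.
by rewrite /Qof (sat_last hs) bet_last mulg1 mul1g Yl.
Qed.

(** [Ered] at [h = 1]. Each unordered pair gives two factors; the one with [Q k x < Q k y] clears a
    denominator of [Ucl], the other one stays in [UV]. *)
Definition Vred J z : F :=
  \prod_(k < N.-1) \prod_(x | (J x <= k)%N) \prod_(y | (J y <= k)%N && (y != x))
    (1 - z y / z x).

Definition UH J Q z h : F :=
  \prod_(k < N.-1) \prod_(x | (J x <= k)%N)
   ((\prod_(y | (J y <= k.+1)%N && (Q k.+1 y < Q k x)%N) (1 - h * z y / z x)) *
    (\prod_(y | (J y <= k)%N && (Q k x < Q k y)%N) (1 - h * z y / z x))).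

Definition UV J Q z : F :=
  \prod_(k < N.-1) \prod_(x | (J x <= k)%N)
   ((\prod_(y | (J y <= k.+1)%N && (Q k x < Q k.+1 y)%N) (1 - z y / z x)) *
    (\prod_(y | (J y <= k)%N && (Q k y < Q k x)%N) (1 - z y / z x))).

Lemma split_neq (T : Type) (idx : T) (op : Monoid.com_law idx) J (q : 'S_n) (k : nat) (x : 'I_n)
    (f : 'I_n -> T) :
  \big[op/idx]_(y | (J y <= k)%N && (y != x)) f y =
  op (\big[op/idx]_(y | (J y <= k)%N && (q x < q y)%N) f y)
     (\big[op/idx]_(y | (J y <= k)%N && (q y < q x)%N) f y).
Proof.
rewrite (bigID (fun y => (q x < q y)%N)) /=; congr (op _ _); apply: eq_bigl => y.
  rewrite -andbA; congr (_ && _); have [->|//] := eqVneq y x; by rewrite ltnn.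
rewrite -andbA; congr (_ && _); rewrite -leqNgt [(q y < _)%N]ltn_neqAle; congr (_ && _).
by rewrite val_eqE (inj_eq (@perm_inj _ q)).
Qed.

Lemma Ucl_V J Q z h : torus z -> injective z -> Ucl J Q z h * Vred J z = UH J Q z h * UV J Q z.
Proof.
move=> hz zi; rewrite /Ucl /Vred /UH /UV -!big_split; apply: eq_bigr => k _ /=.
rewrite -!big_split; apply: eq_bigr => x _ /=.
rewrite (split_neq _ J (Q k)) /= prodf_div.
have : \prod_(y | (J y <= k)%N && (Q k x < Q k y)%N) (1 - z y / z x) != 0.
  apply/prodf_neq0 => y /andP[_ xy]; rewrite subr_eq0 eq_sym.
  apply/eqP => E; have : z y = z x by rewrite -(divfK (hz x) (z y)) E mul1r.
  by move/zi => E'; rewrite E' ltnn in xy.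
move: (\prod_(y | _) _) (\prod_(y | _) _) (\prod_(y | _) _) (\prod_(y | _) _) (\prod_(y | _) _).
by move=> a b c d e a0; field.
Qed.

Definition descending J Q := [forall k : 'I_N.-1, forall x, (J x <= k)%N ==> (Q k.+1 x <= Q k x)%N].

Lemma descendingP J Q : descending J Q ->
  forall k x, (k < N.-1)%N -> (J x <= k)%N -> (Q k.+1 x <= Q k x)%N.
Proof. by move=> H k x hk; move/forallP: H => /(_ (Ordinal hk))/forallP/(_ x)/implyP. Qed.

Lemma not_descending J Q : ~~ descending J Q ->
  exists (k : 'I_N.-1) x, (J x <= k)%N /\ (Q k x < Q k.+1 x)%N.
Proof.
case/forallPn => k /forallPn[x]; rewrite negb_imply -ltnNge => /andP[h1 h2].
by exists k, x.
Qed.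

Lemma Ucl_eq0 J Q z h : torus z -> ~~ descending J Q -> Ucl J Q z h = 0.
Proof.
move=> hz /not_descending[k [x [h1 h2]]].
rewrite /Ucl (bigD1 k) //= (bigD1 x) //= [X in _ * X * _](bigD1 x) ?h2 ?(leqW h1) //=.
by rewrite divff ?hz // subrr !(mul0r, mulr0).
Qed.

Lemma UV_eq0 J Q z : torus z -> ~~ descending J Q -> UV J Q z = 0.
Proof.
move=> hz /not_descending[k [x [h1 h2]]].
rewrite /UV (bigD1 k) //= (bigD1 x) //= [X in X * _ * _ * _](bigD1 x) ?h2 ?(leqW h1) //=.
by rewrite divff ?hz // subrr !(mul0r, mulr0).
Qed.

(** Turns a product over levels into one over pairs whose exponents count levels, so that
    divisibility becomes an inequality of exponents. *)
Lemma prod_count (m : nat) (P : nat -> pred 'I_n) (R : nat -> 'I_n -> pred 'I_n)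
    (f : 'I_n -> 'I_n -> F) :
  \prod_(k < m) \prod_(x | P k x) \prod_(y | R k x y) f x y =
  \prod_x \prod_y f x y ^+ (\sum_(k < m) (P k x && R k x y)).
Proof.
transitivity (\prod_(k < m) \prod_x \prod_y f x y ^+ (P k x && R k x y)).
  apply: eq_bigr => k _; rewrite big_mkcond; apply: eq_bigr => x _.
  case: (P k x) => /=; last by rewrite big1.
  by rewrite big_mkcond; apply: eq_bigr => y _; case: (R k x y).
rewrite exchange_big; apply: eq_bigr => x _; rewrite exchange_big; apply: eq_bigr => y _.
by rewrite /= prodrXr.
Qed.

(* Going up one level lowers the position of [y], so an inversion at level [k]
   survives when only [y] is moved up.  If [J x < J y] then [y] is absent at first,
   and telescoping leaves one more inversion, the one at the top level. *)
Lemma inversion_count J Q x y : descending J Q ->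
  (\sum_(k < N.-1) ((J x <= k)%N && ((J y <= k)%N && (Q k y < Q k x)%N))
   + ((J x < J y)%N && (Q N.-1 y < Q N.-1 x)%N)
   <= \sum_(k < N.-1) ((J x <= k)%N && ((J y <= k.+1)%N && (Q k.+1 y < Q k x)%N)))%N.
Proof.
move=> /descendingP D.
pose A k := (J x <= k)%N && ((J y <= k)%N && (Q k y < Q k x)%N).
pose C k := (J x <= k)%N && ((J y <= k.+1)%N && (Q k.+1 y < Q k x)%N).
have key m : (m <= N.-1)%N ->
    (\sum_(k < m) A k + ((J x < J y)%N && A m) <= \sum_(k < m) C k)%N.
  elim: m => [|m IH] hm.
    by rewrite !big_ord0 /A; case: (J x) (J y) => [a ha] [b hb] /=; lia.
  have := IH (ltnW hm); rewrite !big_ord_recr /=.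
  have AC : A m ==> C m.
    apply/implyP => /and3P[h1 h2 h3]; rewrite /C h1 (leqW h2) /=.
    exact: leq_ltn_trans (D m y hm h2) h3.
  have AC1 : (J x < J y)%N && A m.+1 ==> C m.
    apply/implyP => /andP[h0 /and3P[h1 h2 h3]].
    have h1' : (J x <= m)%N by lia.
    by rewrite /C h1' h2 /=; exact: leq_trans h3 (D m x hm h1').
  move: AC AC1; case: (A m); case: (C m); case: (A m.+1); case: (J x < J y)%N => //=; lia.
have := key _ (leqnn _); rewrite /A !le_last; exact.
Qed.

Lemma UHUV_div J Q : good J Q -> exists2 M, laur2 M & forall z h, torus z -> h != 0 ->
  UH J Q z h * UV J Q z = Ered J z h * evert sigma (finfun J) z h * M z h.
Proof.
move=> [_ Ql]; case: (boolP (descending J Q)) => D; last first.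
  exists (fun _ _ => 0); first exact: laur_cst.
  by move=> z h hz _; rewrite UV_eq0 // !mulr0.
pose g z h x y : F := 1 - h * z y / z x.
pose a x y := (\sum_(k < N.-1) ((J x <= k)%N && ((J y <= k)%N && (Q k y < Q k x)%N)))%N.
pose e x y : bool := (J x < J y)%N && (Q N.-1 y < Q N.-1 x)%N.
pose c x y := (\sum_(k < N.-1) ((J x <= k)%N && ((J y <= k.+1)%N && (Q k.+1 y < Q k x)%N)))%N.
(* [c], [a], [e] are the exponents of [1 - h z_y / z_x] in [UH], [Ered] and [evert], apart from the
   factors with [Q k x < Q k y] that [UH] and [Ered] share. The truncated subtraction is exact by
   [inversion_count]. *)
exists (fun z h => (\prod_x \prod_y g z h x y ^+ (c x y - (a x y + e x y))) * UV J Q z).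
  rewrite /laur2 /UV /g; laur_tac.
move=> z h hz hh; rewrite mulrA; congr (_ * _).
have eE : evert sigma (finfun J) z h = \prod_x \prod_y g z h x y ^+ e x y.
  rewrite /evert (reindex_inj (@perm_inj _ (sigma^-1)%g)); apply: eq_bigr => x _ /=.
  rewrite (reindex_inj (@perm_inj _ (sigma^-1)%g)) big_mkcond; apply: eq_bigr => y _ /=.
  by rewrite !ffunE !permKV /e Ql; case: ifP.
have UE : UH J Q z h = (\prod_x \prod_y g z h x y ^+ c x y) *
   \prod_(k < N.-1) \prod_(x | (J x <= k)%N) \prod_(y | (J y <= k)%N && (Q k x < Q k y)%N) g z h x y.
  rewrite -(prod_count N.-1 (fun k x => (J x <= k)%N)
     (fun k x y => (J y <= k.+1)%N && (Q k.+1 y < Q k x)%N)) -big_split.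
  by apply: eq_bigr => k _ /=; rewrite -big_split.
have EE : Ered J z h = (\prod_x \prod_y g z h x y ^+ a x y) *
   \prod_(k < N.-1) \prod_(x | (J x <= k)%N) \prod_(y | (J y <= k)%N && (Q k x < Q k y)%N) g z h x y.
  rewrite -(prod_count N.-1 (fun k x => (J x <= k)%N)
     (fun k x y => (J y <= k)%N && (Q k y < Q k x)%N)) -big_split.
  apply: eq_bigr => k _ /=; rewrite -big_split; apply: eq_bigr => x _ /=.
  by rewrite (split_neq _ J (Q k)) /= mulrC.
rewrite UE EE eE; set K := \prod_(k < _) _.
suff -> : \prod_x \prod_y g z h x y ^+ c x y = (\prod_x \prod_y g z h x y ^+ a x y) *
    (\prod_x \prod_y g z h x y ^+ e x y) * \prod_x \prod_y g z h x y ^+ (c x y - (a x y + e x y)).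
  move: K (\prod_x _) (\prod_x _) (\prod_x _) => *; ring.
rewrite -!big_split; apply: eq_bigr => x _; rewrite -!big_split; apply: eq_bigr => y _ /=.
by rewrite -!exprD subnKC //; exact: inversion_count.
Qed.
End Families.

(** * Factors prime to the Vandermonde product *)

Section Primes.
Variables (F : numClosedFieldType) (n : nat) (V : ('I_n -> F) -> F -> F).
Implicit Types e f g : ('I_n -> F) -> F -> F.

(* [e] is a nonzero product of primes none of which divides [V]. *)
Definition coprime_to e := nzl (fun x : 'I_n + unit -> F => e (fun i => x (inl i)) (x (inr tt))) /\
  forall f g, laur2 f -> laur2 g ->
    (forall z h, torus z -> h != 0 -> f z h * V z h = e z h * g z h) ->
    exists2 q, laur2 q & forall z h, torus z -> h != 0 -> f z h = e z h * q z h.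

Lemma coprime_to1 : coprime_to (fun _ _ => 1).
Proof.
split.
  split; first exact: laur_cst.
  by exists (fun=> 1) => [v|]; exact: oner_neq0.
by move=> f g lf _ _; exists f => // z h _ _; rewrite mul1r.
Qed.

Lemma coprime_toM e e' : laur2 V -> coprime_to e -> coprime_to e' ->
  coprime_to (fun z h => e z h * e' z h).
Proof.
move=> lV [ne He] [ne' He']; split; first exact: nzl_mul.
move=> f g lf lg H; have [le [x0 hx0 ex0]] := ne; have [le' _] := ne'.
have [|z h hz hh|q lq Hq] := He f (fun z h => e' z h * g z h) lf.
- exact: laur_mul.
- by rewrite H // mulrA.
have [|q' lq' Hq'] := He' q g lq lg.
  apply: (@laur2_domE _ _ _ _ e) => //.
  - exact: laur_mul.
  - exact: laur_mul.
  - by exists (fun i => x0 (inl i)), (x0 (inr tt)); split=> //; exact: hx0.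
  move=> z h hz hh ez; apply: (mulfI ez).
  by rewrite mulrA -Hq // H // mulrA.
by exists q' => // z h hz hh; rewrite Hq // Hq' // mulrA.
Qed.

Lemma coprime_to_prod (I : Type) (r : seq I) (P : pred I) (G : I -> ('I_n -> F) -> F -> F) :
  laur2 V -> (forall i, P i -> coprime_to (G i)) ->
  coprime_to (fun z h => \prod_(i <- r | P i) G i z h).
Proof.
move=> lV hG; elim: r => [|i r IH].
  have -> : (fun z h => \prod_(i <- [::] | P i) G i z h) = (fun _ _ => 1); last exact: coprime_to1.
  by do 2 (apply: functional_extensionality => ?); rewrite big_nil.
case Pi: (P i).
  have -> : (fun z h => \prod_(i <- i :: r | P i) G i z h) =
            (fun z h => G i z h * \prod_(i <- r | P i) G i z h).
    by do 2 (apply: functional_extensionality => ?); rewrite big_cons Pi.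
  by apply: coprime_toM => //; exact: hG.
have -> : (fun z h => \prod_(i <- i :: r | P i) G i z h) =
          (fun z h => \prod_(i <- r | P i) G i z h); last exact: IH.
by do 2 (apply: functional_extensionality => ?); rewrite big_cons Pi.
Qed.

(** Solved for [h], the zero locus is the graph [h = z_x / z_y]. It lies over every [z], so a [V]
    that is nonzero at some [z] for all [h] does not vanish on it identically. *)
Lemma coprime_to_hfactor x y : laur2 V -> (exists2 z, torus z & forall h, V z h != 0) ->
  coprime_to (fun z h => 1 - h * z y / z x).
Proof.
move=> lV [z0 hz0 V0]; split.
  split; first by laur_tac.
  exists (pack2 (fun=> 1) 2); first by apply: tor_pack2 => [i|]; rewrite ?oner_neq0 ?pnatr_eq0.
  rewrite /= invr1 !mulr1 -opprB oppr_eq0 -[2]/(1 + 1) addrK; exact: oner_neq0.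
move=> f g lf lg H.
have [||||q lq Hq] := @laur_div F _ _ _ (inr tt)
    (fun x' : 'I_n + unit -> F => x' (inl x) / x' (inl y)) lf lV.
- by apply: ulaur_mul; [exact: ulaur_var | apply: ulaur_inv; exact: ulaur_var].
- by [].
- exists (pack2 z0 (z0 x / z0 y)).
    by apply: tor_pack2 => //; rewrite mulf_neq0 ?invr_eq0 ?hz0.
  by split=> //; exact: V0.
- move=> t ht E; rewrite H //; try (move=> i; exact: ht).
  by rewrite E divfK ?ht // divff ?ht // subrr mul0r.
(* [1 - h z_y / z_x = - (z_y / z_x) (h - z_x / z_y)]; the unit moves into the quotient. *)
exists (fun z h => - (z x / z y) * q (pack2 z h)).
  have lq' : laur2 (fun z h => q (pack2 z h)).
    apply: (laur_eq lq) => t _; congr q; apply: functional_extensionality.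
    by case=> [i|[]].
  rewrite /laur2; apply: laur_mul => //; laur_tac.
move=> z h hz hh; rewrite (Hq _ (tor_pack2 hz hh)) /= mulrA; congr (_ * _).
have := hz x; have := hz y; move: (z x) (z y) => a b b0 a0; field; by rewrite a0 b0.
Qed.
End Primes.

(** * Laurent property of the restrictions *)

Section Weights.
Variables (F : numClosedFieldType) (N n : nat) (lam : 'I_N -> nat).
Hypothesis Hn : (\sum_(k < N) lam k)%N = n.
Variables (sigma : 'S_n) (I : {ffun 'I_n -> 'I_N}).
Hypothesis HI : is_part lam I.
Let B : 'I_n -> 'I_N := fun x => I (sigma x).
Let partB : forall k : 'I_N, #|[pred x | B x == k]| = lam k := part_comp sigma HI.
Implicit Types (J : {ffun 'I_n -> 'I_N}) (z : 'I_n -> F) (h : F) (Y : nat -> 'S_n).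

Lemma laur2_Ered J : laur2 (fun z h => Ered J z h : F).
Proof. rewrite /laur2 /Ered; laur_tac. Qed.

Lemma laur2_evert J : laur2 (fun z h => evert sigma J z h : F).
Proof. rewrite /laur2 /evert; laur_tac. Qed.

Lemma laur2_Vred J : laur2 (fun z (_ : F) => Vred J z : F).
Proof. rewrite /laur2 /Vred; laur_tac. Qed.

Lemma Vred_neq0 J z : torus z -> injective z -> Vred J z != 0.
Proof.
move=> hz zi; apply/prodf_neq0 => k _; apply/prodf_neq0 => x _; apply/prodf_neq0 => y /andP[_ ne].
rewrite subr_eq0 eq_sym; apply: contra_neq ne => E; apply: zi.
by rewrite -(divfK (hz x) (z y)) E mul1r.
Qed.

Lemma Ered_neq0 J z h : generic z h -> Ered J z h != 0.
Proof.
case=> hz zi hh h1 zh; apply/prodf_neq0 => k _; apply/prodf_neq0 => x _; apply/prodf_neq0 => y _.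
rewrite subr_eq0 eq_sym; apply/eqP => E.
by have := zh x y; rewrite -{1}(mul1r (z x)) -E divfK ?eqxx // hz.
Qed.

Lemma exists_inj_torus : exists2 z : 'I_n -> F, torus z & injective z.
Proof.
exists (fun i : 'I_n => i.+1%:R) => [i|i j /eqP]; first by rewrite pnatr_eq0.
by rewrite eqr_nat eqSS => /eqP/val_inj.
Qed.

Section OneWeight.
Variable G : ('I_N * 'I_n + unit -> F) -> F.
Hypothesis lG : laur G.
Hypothesis HG : forall J Y z h, lvlperm lam J Y -> torus z -> h != 0 -> injective z ->
    G (xY Y z h) = SU lam B J Y z h.

(** Stands for [W(z_J)] without the power of [1 - h], and keeps a meaning where some [z]
    coincide. *)
Definition wt J z h : F := G (xY (Ycan sigma J) z h).

Lemma wtE J Y z h : is_part lam J -> lvlperm lam J Y -> Y N.-1 = sigma ->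
  torus z -> h != 0 -> wt J z h = G (xY Y z h).
Proof.
move=> pJ hY Yl; move: z h; apply: laur2_vand_domE; try exact: laur2_xY.
move=> z h hz hh zi; rewrite /wt (HG (lvlperm_Ycan Hn sigma pJ)) // (HG hY) //.
by apply: (SU_indep Hn partB z h) => //; [exact: lvlperm_Ycan | rewrite Ycan_last].
Qed.

Lemma wt_V J z h : is_part lam J -> torus z -> h != 0 -> wt J z h * Vred J z =
  \sum_(s : {ffun 'I_N -> {perm 'I_n}} | adm lam s)
     UH J (Qof B (Ycan sigma J) s) z h * UV J (Qof B (Ycan sigma J) s) z.
Proof.
move=> pJ; have hY := lvlperm_Ycan Hn sigma pJ.
move: z h; apply: (laur2_vand_domE (f := fun z h => wt J z h * Vred J z)).
- by apply: laur_mul; [exact: (laur2_xY _ lG) | exact: laur2_Vred].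
- rewrite /laur2 /UH /UV; laur_tac.
move=> z h hz hh zi; rewrite /wt (HG hY) // /SU mulr_suml; apply: eq_bigr => s hs.
by rewrite Ucl_V.
Qed.

(** Term by term [Ered * evert] divides [UH * UV], hence it divides [wt * Vred]; being prime to the
    [h]-free [Vred], it divides [wt]. *)
Lemma wt_div J : is_part lam J -> exists2 q, laur2 q & forall z h, torus z -> h != 0 ->
  wt J z h = Ered J z h * evert sigma J z h * q z h.
Proof.
move=> pJ; have hY := lvlperm_Ycan Hn sigma pJ.
pose A := {ffun 'I_N -> {perm 'I_n}}.
have Ad (s : A) : exists M, laur2 M /\ (adm lam s -> forall z h, torus z -> h != 0 ->
    UH J (Qof B (Ycan sigma J) s) z h * UV J (Qof B (Ycan sigma J) s) z
    = Ered J z h * evert sigma J z h * M z h).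
  case: (boolP (adm lam s)) => hs; last by exists (fun _ _ => 0); split; [exact: laur_cst | ].
  have [M lM HM] := UHUV_div F (good_Qof Hn partB hY (Ycan_last _ _) hs).
  by exists M; split=> // _ z h hz hh; rewrite HM // (_ : finfun J = J) //; apply/ffunP => x; rewrite ffunE.
have [M HM] := functional_choice _ Ad.
have [z0 hz0 zi0] := exists_inj_torus.
pose V z (_ : F) := Vred J z.
have lV : laur2 V by exact: laur2_Vred.
have eV : exists2 z, torus z & forall h, V z h != 0.
  by exists z0 => // h; rewrite /V Vred_neq0.
have cp : coprime_to V (fun z h => Ered J z h * evert sigma J z h).
  apply: coprime_toM => //.
    apply: coprime_to_prod => // k _; apply: coprime_to_prod => // x _.
    by apply: coprime_to_prod => // y _; exact: coprime_to_hfactor.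
  apply: coprime_to_prod => // a _; apply: coprime_to_prod => // b _.
  exact: coprime_to_hfactor.
case: cp => _ cp; apply: (cp (wt J) (fun z h => \sum_(s : A | adm lam s) M s z h)).
- exact: laur2_xY.
- by apply: laur_sum => s _; case: (HM s).
move=> z h hz hh; rewrite /V wt_V // mulr_sumr; apply: eq_bigr => s hs.
by case: (HM s) => _; apply.
Qed.

Lemma Ered_tperm J a b z h : z a = z b ->
  Ered [ffun x => J (tperm a b x)] z h = Ered J z h.
Proof.
move=> E; have zt := comp_tperm E.
apply: eq_bigr => k _; rewrite (reindex_inj (@perm_inj _ (tperm a b))).
apply: eq_big => [x|x _]; first by rewrite ffunE tpermK.
rewrite (reindex_inj (@perm_inj _ (tperm a b))).
apply: eq_big => [y|y _]; last by rewrite !zt.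
by rewrite ffunE tpermK (inj_eq (@perm_inj _ _)).
Qed.

Lemma part_tperm J a b : is_part lam J -> is_part lam [ffun x => J (tperm a b x)].
Proof.
move=> pJ k; rewrite -pJ -[RHS](card_image (@perm_inj _ (tperm a b))); apply: eq_card => x.
rewrite [LHS]inE ffunE; apply/idP/imageP => [h|[i h ->]]; last by rewrite tpermK.
by exists (tperm a b x); rewrite ?tpermK.
Qed.

(** Below the top level, a labelling followed by [tperm a b] is a labelling for the exchanged [J];
    if [z_a = z_b], both substitute the same values into [G]. *)
Lemma wt_tperm J a b z h : is_part lam J -> torus z -> h != 0 -> z a = z b ->
  wt [ffun x => J (tperm a b x)] z h = wt J z h.
Proof.
move=> pJ hz hh E.
pose Y k := if (k < N.-1)%N then (Ycan sigma J k * tperm a b)%g else sigma.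
rewrite (@wtE _ Y) //; first last.
- by rewrite /Y ltnn.
- apply: lvlperm_last => [//||k hk c]; first by rewrite /Y ltnn.
  by rewrite /Y hk permM ffunE tpermK; exact: (lvlperm_Ycan Hn sigma pJ (ltnW hk)).
- exact: part_tperm.
congr G; apply: functional_extensionality => -[[k c]|//] /=.
rewrite /Y; case: ltnP => hk; first by rewrite permM (comp_tperm E).
by rewrite /Ycan ltnNge hk.
Qed.

(** The weights agree on [z_a = z_b], and [Ered] can be cancelled there because it does not vanish
    identically on that hyperplane: at [z = 1], [h = 2] all its factors are [-1]. *)
Lemma gkm (r r' : ('I_n -> F) -> F -> F) J a b : is_part lam J -> laur2 r -> laur2 r' ->
  (forall z h, torus z -> h != 0 -> wt J z h = Ered J z h * r z h) ->
  (forall z h, torus z -> h != 0 -> wt [ffun x => J (tperm a b x)] z h =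
      Ered [ffun x => J (tperm a b x)] z h * r' z h) ->
  forall z h, torus z -> h != 0 -> z a = z b -> r' z h = r z h.
Proof.
move=> pJ lr lr' Hr Hr' z h hz hh E.
have key y c : torus y -> c != 0 -> y a = y b -> Ered J y c * r' y c = Ered J y c * r y c.
  by move=> hy hc Ey; rewrite -Hr // -(Ered_tperm J c Ey) -Hr' // wt_tperm.
have [Eab|ab] := eqVneq a b.
  have EJ : [ffun x => J (tperm a b x)] = J by apply/ffunP => x; rewrite ffunE Eab tperm1 perm1.
  rewrite {}EJ in Hr'; apply: (@laur2_generic_domE F n r' r) => // y c gy.
  by case: (gy) => hy _ hc _ _; apply: (mulfI (Ered_neq0 J gy)); rewrite -Hr // -Hr'.
have [||||||q lq Hq] := @laur_div F _ (fun x : 'I_n + unit -> F => r' (fun i => x (inl i)) (x (inr tt)) -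
    r (fun i => x (inl i)) (x (inr tt))) (fun x => Ered J (fun i => x (inl i)) (x (inr tt)))
    (inl b) (fun x => x (inl a)).
- exact: laur_sub.
- exact: laur2_Ered.
- exact: ulaur_var.
- by move=> x c; rewrite /upd; case: eqP => // -[] /eqP; rewrite (negbTE ab).
- exists (pack2 (fun=> 1) 2); first by apply: tor_pack2 => [i|]; rewrite ?oner_neq0 ?pnatr_eq0.
  split=> //=; do 3 (apply/prodf_neq0 => ? _).
  by rewrite invr1 !mulr1 -opprB oppr_eq0 -[2]/(1 + 1) addrK oner_neq0.
- move=> x hx Ex; rewrite mulrC mulrBr key ?subrr //.
apply/eqP; rewrite -subr_eq0; apply/eqP.
by rewrite (Hq _ (tor_pack2 hz hh)) /= E subrr mul0r.
Qed.
End OneWeight.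
End Weights.

(** * Restriction at the diagonal fixed point *)

Section Levels.
Variables (F : numClosedFieldType) (N n : nat).
Implicit Types (z : 'I_n -> F) (h : F).

(** Only [k = J y - 1] can contribute, the step that adds [y]. *)
Lemma level_count (J : 'I_n -> 'I_N) (x y : 'I_n) (b : bool) :
  (\sum_(k < N.-1) ((J x <= k)%N && ((J y == k.+1 :> nat) && b)) = ((J x < J y)%N && b) :> nat)%N.
Proof.
case E: (nat_of_ord (J y)) => [|j].
  by rewrite big1 // => k _; rewrite andbF.
have hj : (j < N.-1)%N by have := ltn_ord (J y); lia.
rewrite (bigD1 (Ordinal hj)) //= eqxx /= ltnS big1 ?addn0 // => k.
rewrite -val_eqE /= eqSS eq_sym => /negbTE ->; by rewrite andbF.
Qed.

Lemma split_level (T : Type) (idx : T) (op : Monoid.com_law idx) (J : 'I_n -> 'I_N) (k : nat)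
    (R : pred 'I_n) (f : 'I_n -> T) :
  \big[op/idx]_(y | (J y <= k.+1)%N && R y) f y =
  op (\big[op/idx]_(y | (J y <= k)%N && R y) f y)
     (\big[op/idx]_(y | (J y == k.+1 :> nat) && R y) f y).
Proof.
rewrite (bigID (fun y => (J y <= k)%N)) /=; congr (op _ _); apply: eq_bigl => y; lia.
Qed.

(** With the same [q] at all levels, the [y] already present at level [k] combine with the quotients
    into [Ered], and for a given [x] each [y] of a later block enters once, at the step that adds
    it. *)
Lemma Ucl_const (J : 'I_n -> 'I_N) (q : 'S_n) z h : torus z -> injective z ->
  Ucl J (fun=> q) z h = Ered J z h *
   ((\prod_x \prod_(y | (J x < J y)%N && (q y < q x)%N) (1 - h * z y / z x)) *
    (\prod_x \prod_(y | (J x < J y)%N && (q x < q y)%N) (1 - z y / z x))).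
Proof.
move=> hz zi.
have cnt (R : 'I_n -> pred 'I_n) (f : 'I_n -> 'I_n -> F) :
    \prod_x \prod_(y | (J x < J y)%N && R x y) f x y =
    \prod_(k < N.-1) \prod_(x | (J x <= k)%N) \prod_(y | (J y == k.+1 :> nat) && R x y) f x y.
  rewrite (prod_count N.-1 (fun k x => (J x <= k)%N) (fun k x y => (J y == k.+1 :> nat) && R x y)).
  apply: eq_bigr => x _; rewrite big_mkcond; apply: eq_bigr => y _.
  by rewrite level_count; case: ifP.
rewrite !cnt -!big_split; apply: eq_bigr => k _ /=; rewrite -!big_split; apply: eq_bigr => x _ /=.
rewrite !split_level (split_neq _ J q) /= prodf_div.
have : \prod_(y | (J y <= k)%N && (q x < q y)%N) (1 - z y / z x) != 0.
  apply/prodf_neq0 => y /andP[_ xy]; rewrite subr_eq0 eq_sym.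
  apply/eqP => E; have : z y = z x by rewrite -(divfK (hz x) (z y)) E mul1r.
  by move/zi => E'; rewrite E' ltnn in xy.
move: (\prod_(y | _) _) (\prod_(y | _) _) (\prod_(y | _) _) (\prod_(y | _) _) (\prod_(y | _) _) => a b c d e a0.
by field.
Qed.

End Levels.

Section Diagonal.
Variables (F : numClosedFieldType) (N n : nat) (lam : 'I_N -> nat).
Hypothesis Hn : (\sum_(k < N) lam k)%N = n.
Variables (sigma : 'S_n) (I : {ffun 'I_n -> 'I_N}).
Hypothesis HI : is_part lam I.
Let B : 'I_n -> 'I_N := fun x => I (sigma x).
Let partB : forall k : 'I_N, #|[pred x | B x == k]| = lam k := part_comp sigma HI.
Implicit Types (z : 'I_n -> F) (h : F).

(** Downward induction: [Q k] and [sigma^-1] carry the first blocks of [I] onto the same set, so a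
    pointwise inequality between them has equal sums and is an equality. *)
Lemma good_descending_id Q : good B sigma I Q -> descending I Q ->
  forall k, (k <= N.-1)%N -> forall x, (I x <= k)%N -> Q k x = (sigma^-1)%g x.
Proof.
move=> [gQ Ql] /descendingP D k hk; have [d Ed] : exists d, (k + d = N.-1)%N by exists (N.-1 - k)%N; lia.
elim: d k hk Ed => [|d IH] k hk Ed x Ix.
  have -> : k = N.-1 by lia.
  by rewrite Ql.
have hk' : (k < N.-1)%N by lia.
have le y : (I y <= k)%N -> ((sigma^-1)%g y <= Q k y)%N.
  by move=> Iy; rewrite -(IH k.+1) ?(leqW Iy) //; [exact: D | lia].
have Es : (\sum_(y | (I y <= k)%N) ((sigma^-1)%g y : nat) = \sum_(y | (I y <= k)%N) (Q k y : nat))%N.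
  rewrite (reindex_inj (@perm_inj _ sigma)) [RHS](reindex_inj (@perm_inj _ (Q k)^-1%g)) /=.
  apply: eq_big => [u|u _]; last by rewrite permK permKV.
  by rewrite -(gQ k hk ((Q k)^-1%g u)) permKV.
have := leqif_sum (fun y Iy => leqif_eq (le y Iy)).
case=> _; rewrite Es eqxx => /esym/forall_inP/(_ x Ix)/eqP E.
exact/val_inj/esym.
Qed.

(** The factor [- z_y / z_x] of [Pf] turns [1 - z_x / z_y] of [ef] into [1 - z_y / z_x]. *)
Lemma Pf_ef z h : torus z -> Pf sigma I z h * ef sigma I z h =
   (\prod_x \prod_(y | (I x < I y)%N && ((sigma^-1)%g y < (sigma^-1)%g x)%N) (1 - h * z y / z x)) *
   (\prod_x \prod_(y | (I x < I y)%N && ((sigma^-1)%g x < (sigma^-1)%g y)%N) (1 - z y / z x)).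
Proof.
move=> hz; rewrite /ef mulrCA; congr (_ * _).
  rewrite /evert (reindex_inj (@perm_inj _ (sigma^-1)%g)); apply: eq_bigr => x _ /=.
  rewrite (reindex_inj (@perm_inj _ (sigma^-1)%g)).
  by apply: eq_big => [y|y _]; rewrite !permKV.
rewrite /Pf -big_split (reindex_inj (@perm_inj _ (sigma^-1)%g)); apply: eq_bigr => x _ /=.
rewrite -big_split (reindex_inj (@perm_inj _ (sigma^-1)%g)).
apply: eq_big => [y|y _] /=; rewrite !permKV //.
have := hz x; have := hz y; move: (z x) (z y) => a b b0 a0; by field; rewrite a0 b0.
Qed.

Lemma SU_diag z h : torus z -> injective z ->
  SU lam B I (fun k => (bet B k * sigma)%g) z h = Ered I z h * (Pf sigma I z h * ef sigma I z h).
Proof.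
(* With this labelling the identity family gives [Q k = sigma^-1] at every level, which makes the
   surviving term explicit. *)
move=> hz zi; pose Y k := (bet B k * sigma)%g.
have hY : lvlperm lam I Y by move=> k hk a; rewrite /Y permM (bet_mem partB).
have Yl : Y N.-1 = sigma by rewrite /Y bet_last mul1g.
pose s1 : {ffun 'I_N -> {perm 'I_n}} := [ffun=> 1%g].
have as1 : adm lam s1 by apply/admP => k i; rewrite ffunE perm1 eqxx.
rewrite /SU -/Y (bigD1 s1) //= big1 ?addr0.
  have -> : Qof B Y s1 = fun=> (sigma^-1)%g.
    apply: functional_extensionality => k; rewrite /Qof /sat /Y.
    by case: insub => [k'|]; rewrite ?ffunE mul1g invMg mulgKV.
  by rewrite Ucl_const // Pf_ef.
move=> s /andP[hs ns]; apply: Ucl_eq0 => //; apply: contra ns => D.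
apply/eqP/ffunP => k; rewrite ffunE; apply/permP => i; rewrite perm1.
apply/eqP/negPn/negP => ne; have /andP[hi hk] := admP _ _ hs k i ne.
have gQ := good_Qof Hn partB hY Yl hs.
have sk : sat s k = s k by rewrite /sat valK.
pose x := Y k (s k i).
have Ix : (I x <= k)%N by rewrite -hY ?(ltnW hk) // -sk (sat_lt _ _ hs).
have := good_descending_id gQ D (ltnW hk) Ix.
have -> : Qof B Y s k x = bet B k i by rewrite /Qof sk permM /x -(permM (s k)) permK.
have -> : (sigma^-1)%g x = bet B k (s k i) by rewrite /x /Y permM permK.
move=> /perm_inj E.
by rewrite -E eqxx in ne.
Qed.
End Diagonal.

(** * Smallness *)

Section Range.
Variable F : numClosedFieldType.
Implicit Types (f g : F -> F) (P : {poly F}).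

(* [f] is a Laurent polynomial in [q] with exponents in [[-A, B]]; in [rngx] both
   ends are attained. *)
Definition rng (A B : nat) f := exists2 P : {poly F}, (size P <= (A + B).+1)%N &
  forall q, q != 0 -> q ^+ A * f q = P.[q].
Definition rngx (A B : nat) f := exists2 P : {poly F}, size P = (A + B).+1 /\ P.[0] != 0 &
  forall q, q != 0 -> q ^+ A * f q = P.[q].

Lemma rng_mul A B A' B' f g : rng A B f -> rng A' B' g ->
  rng (A + A') (B + B') (fun q => f q * g q).
Proof.
move=> [P sP HP] [Q sQ HQ]; exists (P * Q).
  by apply: leq_trans (size_polyMleq _ _) _; lia.
by move=> q hq; rewrite hornerM -HP // -HQ // exprD; ring.
Qed.

Lemma rngx_mul A B A' B' f g : rngx A B f -> rngx A' B' g ->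
  rngx (A + A') (B + B') (fun q => f q * g q).
Proof.
move=> [P [sP P0] HP] [Q [sQ Q0] HQ]; exists (P * Q).
  split; last by rewrite hornerM mulf_neq0.
  by rewrite size_mul -?size_poly_eq0 ?sP ?sQ //; lia.
by move=> q hq; rewrite hornerM -HP // -HQ // exprD; ring.
Qed.

Lemma rng_prod (I : Type) (r : seq I) (C : pred I) (A B : I -> nat) (f : I -> F -> F) :
  (forall i, C i -> rng (A i) (B i) (f i)) ->
  rng (\sum_(i <- r | C i) A i) (\sum_(i <- r | C i) B i) (fun q => \prod_(i <- r | C i) f i q).
Proof.
move=> H; elim: r => [|i r IH].
  exists 1; first by rewrite size_poly1.
  by move=> q _; rewrite !big_nil !hornerE ?expr0 ?mulr1.
rewrite !big_cons; case Ci: (C i); last first.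
  by have [P sP HP] := IH; exists P => // q hq; rewrite big_cons Ci HP.
have [P sP HP] := rng_mul (H i Ci) IH; exists P => // q hq.
by rewrite big_cons Ci HP.
Qed.

Lemma rngx_prod (I : Type) (r : seq I) (C : pred I) (A B : I -> nat) (f : I -> F -> F) :
  (forall i, C i -> rngx (A i) (B i) (f i)) ->
  rngx (\sum_(i <- r | C i) A i) (\sum_(i <- r | C i) B i) (fun q => \prod_(i <- r | C i) f i q).
Proof.
move=> H; elim: r => [|i r IH].
  exists 1; first by rewrite size_poly1 !big_nil !hornerE oner_neq0.
  by move=> q _; rewrite !big_nil !hornerE ?expr0 ?mulr1.
rewrite !big_cons; case Ci: (C i); last first.
  by have [P sP HP] := IH; exists P => // q hq; rewrite big_cons Ci HP.
have [P sP HP] := rngx_mul (H i Ci) IH; exists P => // q hq.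
by rewrite big_cons Ci HP.
Qed.

Lemma rng_weaken A B A' B' f : (A <= A')%N -> (B <= B')%N -> rng A B f -> rng A' B' f.
Proof.
move=> hA hB [P sP HP]; exists ('X^(A' - A) * P).
  by apply: leq_trans (size_polyMleq _ _) _; rewrite size_polyXn; lia.
by move=> q hq; rewrite hornerM hornerXn -HP // mulrA -exprD subnK.
Qed.

Lemma rng_sum (I : Type) (r : seq I) (C : pred I) A B (f : I -> F -> F) :
  (forall i, C i -> rng A B (f i)) -> rng A B (fun q => \sum_(i <- r | C i) f i q).
Proof.
move=> H; elim: r => [|i r [P sP HP]].
  exists 0; first by rewrite size_poly0.
  by move=> q _; rewrite big_nil mulr0 horner0.
case Ci: (C i); last by exists P => // q hq; rewrite big_cons Ci HP.
have [P' sP' HP'] := H i Ci; exists (P' + P).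
  by apply: leq_trans (size_polyD _ _) _; rewrite geq_max sP sP'.
by move=> q hq; rewrite big_cons Ci mulrDr hornerD HP // HP'.
Qed.

Lemma rng_ext A B f g : rng A B f -> (forall q, q != 0 -> g q = f q) -> rng A B g.
Proof. by move=> [P sP HP] E; exists P => // q hq; rewrite E // HP. Qed.

Lemma rngx_ext A B f g : rngx A B f -> (forall q, q != 0 -> g q = f q) -> rngx A B g.
Proof. by move=> [P sP HP] E; exists P => // q hq; rewrite E // HP. Qed.

Lemma factor_clear (a b : nat) (u q : F) : q != 0 ->
  q ^+ (a - b) * (1 - u * q ^ (b%:Z - a%:Z)) = q ^+ (a - b) - u * q ^+ (b - a).
Proof.
move=> hq; rewrite mulrBr mulr1 mulrCA; congr (_ - _ * _).
by rewrite !exprnP -expfzDr //; congr (_ ^ _); lia.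
Qed.

Lemma rng_factor (a b : nat) (u : F) : rng (a - b) (b - a) (fun q => 1 - u * q ^ (b%:Z - a%:Z)).
Proof.
exists ('X^(a - b) - u *: 'X^(b - a)).
  apply: leq_trans (size_polyD _ _) _; rewrite size_polyN geq_max size_polyXn.
  by rewrite (leq_trans (size_scale_leq _ _)) ?size_polyXn //; lia.
by move=> q hq; rewrite factor_clear // hornerD hornerN hornerZ !hornerXn.
Qed.

(** [u != 0] makes both ends attained for [a != b]; [u != 1] makes the constant [1 - u] nonzero for
    [a = b]. *)
Lemma rngx_factor (a b : nat) (u : F) : u != 0 -> u != 1 ->
  rngx (a - b) (b - a) (fun q => 1 - u * q ^ (b%:Z - a%:Z)).
Proof.
move=> u0 u1; exists ('X^(a - b) - u *: 'X^(b - a)); last first.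
  by move=> q hq; rewrite factor_clear // hornerD hornerN hornerZ !hornerXn.
rewrite hornerD hornerN hornerZ !hornerXn.
case: (ltngtP a b) => ab.
- have -> : (a - b = 0)%N by lia.
  have : (0 < b - a)%N by lia.
  case: (b - a)%N => // m _; split.
    rewrite addrC size_polyDl ?size_polyN size_scale ?size_polyXn //.
  by rewrite expr0 expr0n /= mulr0 subr0 oner_neq0.
- have -> : (b - a = 0)%N by lia.
  have : (0 < a - b)%N by lia.
  case: (a - b)%N => // m _; split.
    by rewrite size_polyDl ?size_polyN ?size_scale ?size_polyXn ?addn0.
  by rewrite expr0 expr0n /= mulr1 sub0r oppr_eq0.
rewrite ab subnn !expr0 alg_polyC -polyCB size_polyC mulr1.
by rewrite !subr_eq0 eq_sym u1.
Qed.

(** The end exponents of [f0] are attained, so those of the quotient [f1 / f0] lie in [[0, M]] and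
    the terms of [L] outside this range cancel. The conclusion is this identity at [q = 1]. *)
Lemma laurent_range (L : seq (F * int)) (f0 f1 : F -> F) (A B M : nat) :
  rngx A B f0 -> rng A (B + M) f1 ->
  (forall q, q != 0 -> (\sum_(t <- L) t.1 * q ^ t.2) * f0 q = f1 q) ->
  \sum_(t <- L) t.1 = \sum_(t <- L | (0 <= t.2) && (t.2 <= M%:Z)) t.1.
Proof.
move=> [P0 [sP0 P00] HP0] [P1 sP1 HP1] H.
have [K HK] : exists K : nat, all (fun t : F * int => 0 <= t.2 + K%:Z) L.
  elim: L {H} => [|t L [K HK]]; first by exists 0%N.
  exists (K + absz t.2)%N => /=; apply/andP; split; first by lia.
  by apply: sub_all HK => s; lia.
pose R (C : pred int) : {poly F} := \sum_(t <- L | C t.2) t.1 *: 'X^(absz (t.2 + K%:Z)).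
have R1 C : (R C).[1] = \sum_(t <- L | C t.2) t.1.
  by rewrite horner_sum; apply: eq_bigr => t _; rewrite hornerZ hornerXn expr1n mulr1.
have RE q : q != 0 -> (R xpredT).[q] = q ^+ K * \sum_(t <- L) t.1 * q ^ t.2.
  move=> hq; rewrite horner_sum mulr_sumr; apply: eq_big_seq => t tL.
  rewrite hornerZ hornerXn mulrCA; congr (_ * _).
  by rewrite !exprnP gez0_abs ?(allP HK) // expfzDr // mulrC.
have PE : R xpredT * P0 = 'X^K * P1.
  apply/eqP; rewrite -subr_eq0; apply/negPn/negP => nz.
  have nz' : (R xpredT * P0 - 'X^K * P1) * 'X != 0 by rewrite mulf_neq0 ?polyX_eq0.
  have [q] := nonroot nz'; rewrite hornerM hornerX mulf_eq0 negb_or => /andP[h1 hq].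
  move: h1; rewrite hornerD hornerN !hornerM hornerXn RE // -HP0 // -HP1 // -H //.
  by apply/negP/negPn; rewrite subr_eq0; apply/eqP; ring.
(* Lower end: [P0.[0] != 0] forces all of ['X^K] into [R xpredT]. The upper end is the comparison of
   sizes below. *)
have cop : coprimep 'X^K P0.
  by apply: coprimep_expl; rewrite -['X]subr0 -polyC0 coprimep_sym coprimep_XsubC.
have dv : 'X^K %| R xpredT by rewrite -(Gauss_dvdpl _ cop) PE dvdp_mulr.
have [S ES] := dvdpP _ _ dv.
have P0n : P0 != 0 by apply: contraNneq P00 => ->; rewrite horner0.
have SE : S * P0 = P1.
  apply: (mulfI (_ : 'X^K != 0)); first by rewrite monic_neq0 ?monicXn.
  by rewrite mulrA [_ * S]mulrC -ES PE.
have sS : (size S <= M.+1)%N.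
  have [->|S0] := eqVneq S 0; first by rewrite size_poly0.
  by move: sP1; rewrite -SE size_mul // sP0; move: (size _) => m; lia.
have coefR C i : (R C)`_i = \sum_(t <- L | C t.2) t.1 * (i == absz (t.2 + K%:Z))%:R.
  by rewrite coef_sum; apply: eq_bigr => t _; rewrite coefZ coefXn.
suff E : R xpredT = R (fun j => (0 <= j) && (j <= M%:Z)) by rewrite -(R1 (fun j => (0 <= j) && (j <= M%:Z))) -E R1.
apply/polyP => i; case: (boolP ((K <= i) && (i <= K + M))%N) => hi.
  rewrite !coefR [RHS]big_mkcond; apply: eq_big_seq => t tL; case: ifP => // /negP ht.
  have := allP HK _ tL => /= hK; case: eqP => [Ei|]; last by rewrite mulr0.
  by case: ht; lia.
transitivity (0 : F).
  rewrite ES mulrC coefXnM; case: ltnP => // Ki.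
  by apply: nth_default; apply: leq_trans sS _; lia.
rewrite coefR big_seq_cond big1 // => t /andP[tL ht].
have := allP HK _ tL => /= hK; case: eqP => [Ei|]; last by rewrite mulr0.
lia.
Qed.
End Range.

(** * Counting degrees *)

Section DegreeSums.
Variables (N n : nat) (lam : 'I_N -> nat).
Variables (sigma : 'S_n) (I : {ffun 'I_n -> 'I_N}).
Hypothesis HI : is_part lam I.
Let B : 'I_n -> 'I_N := fun x => I (sigma x).
Variables (J : {ffun 'I_n -> 'I_N}) (Q : nat -> 'S_n).
Hypothesis HJ : is_part lam J.
Hypothesis gQ : good B sigma J Q.
Implicit Types D : 'I_n -> 'I_n -> nat.
Local Open Scope nat_scope.

(** With [D = Dm] and [D = Dp], bounds below and above for the exponents of [q] in [UH] along
    [z_x |-> q^(J x + 1) z_x]; [SV] serves [UV], and [S0] both [Ered] and [Vred]. *)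
Definition SH D := \sum_(k < N.-1) \sum_(x | J x <= k)
   (\sum_(y | (J y <= k.+1) && (Q k.+1 y < Q k x)) D x y +
    \sum_(y | (J y <= k) && (Q k x < Q k y)) D x y).

Definition SV D := \sum_(k < N.-1) \sum_(x | J x <= k)
   (\sum_(y | (J y <= k.+1) && (Q k x < Q k.+1 y)) D x y +
    \sum_(y | (J y <= k) && (Q k y < Q k x)) D x y).

Definition S0 D := \sum_(k < N.-1) \sum_(x | J x <= k) \sum_(y | (J y <= k) && (y != x)) D x y.

(** The excluded [y] is the partner of [x], which has the same index one level up and therefore
    gives no factor. *)
Definition S1 D := \sum_(k < N.-1) \sum_(x | J x <= k)
   \sum_(y | (J y <= k.+1) && (y != (Q k.+1)^-1%g (Q k x))) D x y.

Definition Dm (x y : 'I_n) : nat := J x - J y.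
Definition Dp (x y : 'I_n) : nat := J y - J x.
Definition Mn : nat := \sum_x \sum_y Dp x y.

Lemma SH_SV D : SH D + SV D = S0 D + S1 D.
Proof.
rewrite /SH /SV /S0 /S1 -!big_split; apply: eq_bigr => k _ /=.
rewrite -!big_split; apply: eq_bigr => x _ /=.
rewrite (split_neq _ J (Q k)) (split_neq _ J (Q k.+1)) /= permKV; lia.
Qed.

Lemma sum_level D k x : D x x = 0 ->
  \sum_(y | J y <= k.+1) D x y =
  \sum_(y | (J y <= k) && (y != x)) D x y + \sum_(y | J y == k.+1 :> nat) D x y.
Proof.
move=> D0; have := split_level addn J k xpredT (D x) => /= E.
under eq_bigl do rewrite -[_ <= _]andbT; rewrite E; congr (_ + _); last first.
  by apply: eq_bigl => y; rewrite andbT.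
under eq_bigl do rewrite andbT.
case: (boolP (J x <= k)) => hx; last first.
  apply: eq_bigl => y; have [->|] := eqVneq y x; rewrite ?andbT //; by rewrite (negbTE hx).
by rewrite (bigD1 x) //= D0 add0n.
Qed.

(** The elements that level [k + 1] adds have larger [J] than [x], so their [Dm] is 0. *)
Lemma S1_Dm : S1 Dm <= S0 Dm.
Proof.
apply: leq_sum => k _; apply: leq_sum => x hx.
apply: (@leq_trans (\sum_(y | J y <= k.+1) Dm x y)).
  rewrite [X in _ <= X](bigID (fun y => y != (Q k.+1)^-1%g (Q k x))) /=; exact: leq_addr.
rewrite sum_level ?[X in _ + X]big1 ?addn0 // => [y /eqP Ey|]; rewrite /Dm ?subnn //; lia.
Qed.

(** A pair with [J x < J y] contributes to the surplus [Mn] exactly once, when [y] is added. *)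
Lemma total_Dp : \sum_(k < N.-1) \sum_(x | J x <= k) \sum_(y | J y <= k.+1) Dp x y = S0 Dp + Mn.
Proof.
transitivity (S0 Dp + \sum_(k < N.-1) \sum_(x | J x <= k) \sum_(y | J y == k.+1 :> nat) Dp x y).
  rewrite /S0 -big_split; apply: eq_bigr => k _ /=; rewrite -big_split; apply: eq_bigr => x _ /=.
  by rewrite sum_level // /Dp subnn.
congr (_ + _); transitivity (\sum_(k < N.-1) \sum_x \sum_y
    ((J x <= k) && ((J y == k.+1 :> nat) && true)) * Dp x y).
  apply: eq_bigr => k _; rewrite big_mkcond; apply: eq_bigr => x _.
  case: (J x <= k) => /=; last by rewrite big1.
  by rewrite big_mkcond; apply: eq_bigr => y _; case: eqP => _; rewrite ?mul1n ?mul0n.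
rewrite exchange_big; apply: eq_bigr => x _; rewrite exchange_big; apply: eq_bigr => y _ /=.
rewrite -big_distrl /= level_count andbT /Dp; case: ltnP => h; rewrite ?mul1n //; lia.
Qed.

Lemma S1_total : S1 Dp + \sum_(k < N.-1) \sum_(x | J x <= k) Dp x ((Q k.+1)^-1%g (Q k x)) =
  S0 Dp + Mn.
Proof.
rewrite -total_Dp /S1 -big_split; apply: eq_bigr => k _ /=; rewrite -big_split; apply: eq_bigr => x hx /=.
have [g _] := gQ; have k1 : k <= N.-1 by exact: ltnW.
have k2 : k.+1 <= N.-1 by exact: ltn_ord.
rewrite [RHS](bigD1 ((Q k.+1)^-1%g (Q k x))) /= 1?addnC //.
by rewrite -g // permKV leqW // g.
Qed.

Lemma sum_part (K : {ffun 'I_n -> 'I_N}) : is_part lam K ->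
  \sum_x nat_of_ord (K x) = \sum_(k < N) lam k * k.
Proof.
move=> pK; rewrite (partition_big K xpredT) //=; apply: eq_bigr => k _.
rewrite (eq_bigr (fun=> nat_of_ord k)) => [|x /eqP -> //].
by rewrite sum_nat_const -pK; congr (_ * _); apply: eq_card => x; rewrite !inE.
Qed.

(* If no step raised [J], then [J (sigma u) <= I (sigma u)] for all [u]. *)
Lemma strict_step : J != I -> exists (k : 'I_N.-1) x,
  J x <= k /\ 0 < Dp x ((Q k.+1)^-1%g (Q k x)).
Proof.
move=> JI; case: (boolP [exists k : 'I_N.-1, exists x, (J x <= k) && (0 < Dp x ((Q k.+1)^-1%g (Q k x)))]).
  by move=> /existsP[k /existsP[x /andP[h1 h2]]]; exists k, x.
move=> /existsPn H; case/negP: JI; have [g Ql] := gQ.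
have st k x : k < N.-1 -> J x <= k -> J ((Q k.+1)^-1%g (Q k x)) <= J x.
  move=> hk hx; have /existsPn/(_ x) := H (Ordinal hk).
  by rewrite /= hx /= -eqn0Ngt /Dp subn_eq0.
(* Follow [u] upwards through the levels: successive [(Q k)^-1 u] are partners, and the last one is
   [sigma u]. *)
have key d k u : k + d = N.-1 -> B u <= k -> J (sigma u) <= J ((Q k)^-1%g u).
  elim: d k u => [|d IH] k u hd hu.
    have -> : k = N.-1 by lia.
    by rewrite Ql invgK.
  apply: leq_trans (IH k.+1 u _ (leqW hu)) _; first by lia.
  have hx : J ((Q k)^-1%g u) <= k by rewrite -g ?permKV //; lia.
  by have := st k _ _ hx; rewrite permKV; apply; lia.
have le' u : J (sigma u) <= I (sigma u).
  have hB := le_last B u.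
  apply: leq_trans (key (N.-1 - B u) (B u) u (subnKC hB) (leqnn _)) _.
  by change (J ((Q (B u))^-1%g u) <= B u); rewrite -(g _ hB) permKV.
have le x : J x <= I x by rewrite -(permKV sigma x).
(* Both partitions have the same total of block numbers, so [J <= I] forces [J = I]. *)
have := leqif_sum (fun x (_ : true) => leqif_eq (le x)).
case=> _; rewrite !sum_part // eqxx => /esym/forallP E.
by apply/eqP/ffunP => x; apply/val_inj/eqP; exact: (E x).
Qed.

(** The drop from [Mn] to [Mn.-1] is due to the partner in a strict step, whose positive [Dp] is
    missing from [S1]. *)
Lemma degree_bounds : J != I ->
  [/\ SH Dm + SV Dm <= S0 Dm + S0 Dm, SH Dp + SV Dp <= S0 Dp + S0 Dp + Mn.-1 & 0 < Mn].
Proof.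
move=> JI; rewrite !SH_SV leq_add2l S1_Dm; have [k [x [hx hD]]] := strict_step JI.
have pos : 0 < \sum_(k < N.-1) \sum_(x | J x <= k) Dp x ((Q k.+1)^-1%g (Q k x)).
  rewrite (bigD1 k) //= (bigD1 x) //=; lia.
have := S1_total => E; split=> //; last first.
  rewrite lt0n; apply/eqP => M0.
  have : Dp x ((Q k.+1)^-1%g (Q k x)) <= Mn.
    by rewrite /Mn (bigD1 x) //= (bigD1 ((Q k.+1)^-1%g (Q k x))) //= -addnA leq_addr.
  by rewrite M0; lia.
lia.
Qed.

Lemma Mbound_Mn : Mbound lam = Mn%:Z.
Proof.
have -> : Mn = \sum_(k < N) \sum_(l < N | k < l) lam k * lam l * (l - k).
  rewrite /Mn (partition_big J xpredT) //=; apply: eq_bigr => k _.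
  rewrite (eq_bigr (fun=> \sum_y (J y - k))) => [|x /eqP <- //].
  rewrite sum_nat_const (_ : #|_| = lam k); last by rewrite -HJ; apply: eq_card => x; rewrite !inE.
  rewrite (partition_big J xpredT) //= big_distrr [RHS]big_mkcond; apply: eq_bigr => l _ /=.
  rewrite (eq_bigr (fun=> (l - k))) => [|x /eqP <- //].
  rewrite sum_nat_const (_ : #|_| = lam l); last by rewrite -HJ; apply: eq_card => x; rewrite !inE.
  case: ltnP => h; [by rewrite mulnA | have -> : l - k = 0 by lia]; by rewrite !muln0.
rewrite /Mbound (big_morph Posz PoszD (erefl _)); apply: eq_bigr => k _.
by rewrite (big_morph Posz PoszD (erefl _)).
Qed.
End DegreeSums.

(** * Degrees along a one-parameter subgroup *)

Section OneParameter.
Variables (F : numClosedFieldType) (N n : nat) (J : {ffun 'I_n -> 'I_N}).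
Variables (z : 'I_n -> F) (h : F).

(** The shift by 1 matches [phiJ], which numbers blocks from 1: the monomial [e] scales by
    [q ^ phiJ J e]. *)
Definition zq (q : F) : 'I_n -> F := fun x => q ^+ (J x).+1 * z x.

Hypothesis hz : torus z.

Lemma torus_zq q : q != 0 -> torus (zq q).
Proof. by move=> hq x; rewrite mulf_neq0 ?expf_neq0. Qed.

Lemma zq_ratio q x y : q != 0 -> zq q y / zq q x = z y / z x * q ^ ((J y)%:Z - (J x)%:Z).
Proof.
move=> hq; rewrite /zq invfM mulrACA mulrC; congr (_ * _).
rewrite !exprnP invr_expz -expfzDr //; congr (_ ^ _); lia.
Qed.

Lemma mon_zq (e : 'I_n -> int) q : q != 0 -> mon e (zq q) = mon e z * q ^ phiJ J e.
Proof.
move=> hq; rewrite /mon /phiJ (big_morph (fun j => q ^ j) (fun i j => expfzDr i j hq) (expr0z q)).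
rewrite -big_split; apply: eq_bigr => a _ /=.
by rewrite /zq expfzMl mulrC exprnP exprz_exp.
Qed.

Lemma rng_h (c : F) x y : rng (Dm J x y) (Dp J x y) (fun q => 1 - c * zq q y / zq q x).
Proof.
apply: rng_ext (rng_factor (J x) (J y) (c * z y / z x)) _ => q hq.
by rewrite -mulrA zq_ratio // !mulrA.
Qed.

Lemma rng_v x y : rng (Dm J x y) (Dp J x y) (fun q => 1 - zq q y / zq q x).
Proof. by apply: rng_ext (rng_h 1 x y) _ => q hq; rewrite mul1r. Qed.

Lemma rng_UH Q : rng (SH J Q (Dm J)) (SH J Q (Dp J)) (fun q => UH J Q (zq q) h).
Proof.
apply: rng_prod => k _; apply: rng_prod => x _; apply: rng_mul;
  apply: rng_prod => y _; exact: rng_h.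
Qed.

Lemma rng_UV Q : rng (SV J Q (Dm J)) (SV J Q (Dp J)) (fun q => UV J Q (zq q)).
Proof.
apply: rng_prod => k _; apply: rng_prod => x _; apply: rng_mul;
  apply: rng_prod => y _; exact: rng_v.
Qed.

Hypothesis hg : generic z h.

Lemma ratio_neq1 (a b : F) : b != 0 -> a != b -> a / b != 1.
Proof. by move=> b0; apply: contra_neq => E; rewrite -(divfK b0 a) E mul1r. Qed.

Lemma rngx_Ered : rngx (S0 J (Dm J)) (S0 J (Dp J)) (fun q => Ered J (zq q) h).
Proof.
have [_ _ hh _ zh] := hg.
apply: rngx_prod => k _; apply: rngx_prod => x _; apply: rngx_prod => y _.
apply: rngx_ext (@rngx_factor F (J x) (J y) (h * z y / z x) _ _) _ => [||q hq].
- by rewrite !mulf_neq0 ?invr_eq0 ?hz.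
- by apply: ratio_neq1 => //; rewrite eq_sym.
by rewrite -mulrA zq_ratio // !mulrA.
Qed.

Lemma rngx_Vred : rngx (S0 J (Dm J)) (S0 J (Dp J)) (fun q => Vred J (zq q)).
Proof.
have [_ zi _ _ _] := hg.
apply: rngx_prod => k _; apply: rngx_prod => x _; apply: rngx_prod => y /andP[_ ne].
apply: rngx_ext (@rngx_factor F (J x) (J y) (z y / z x) _ _) _ => [||q hq].
- by rewrite mulf_neq0 ?invr_eq0 ?hz.
- by apply: ratio_neq1 => //; apply: contra_neq ne; exact: zi.
by rewrite zq_ratio.
Qed.
End OneParameter.

Lemma In_filter (T : Type) (a : pred T) x s : List.In x (filter a s) -> a x.
Proof. by elim: s => //= y s IH; case: ifP => // ay [<-|]. Qed.

Section Small.
Variables (F : numClosedFieldType) (N n : nat) (lam : 'I_N -> nat).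
Hypothesis Hn : (\sum_(k < N) lam k)%N = n.
Variables (sigma : 'S_n) (I : {ffun 'I_n -> 'I_N}).
Hypothesis HI : is_part lam I.
Let B : 'I_n -> 'I_N := fun x => I (sigma x).
Let partB : forall k : 'I_N, #|[pred x | B x == k]| = lam k := part_comp sigma HI.
Variable G : ('I_N * 'I_n + unit -> F) -> F.
Hypothesis lG : laur G.
Hypothesis HG : forall (J : {ffun 'I_n -> 'I_N}) Y z h, lvlperm lam J Y -> torus z -> h != 0 ->
  injective z -> G (xY Y z h) = SU lam B J Y z h.
Implicit Type J : {ffun 'I_n -> 'I_N}.

(** The given representation [L] of [r] may contain cancelling monomials outside the range;
    discarding them leaves a representation at generic points, hence everywhere. *)
Lemma small_of_wt J (r : ('I_n -> F) -> F -> F) : is_part lam J -> J != I -> laur2 r ->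
  (forall z h, torus z -> h != 0 -> wt sigma G J z h = Ered J z h * r z h) -> small lam J r.
Proof.
move=> pJ JI /laur2P lr Hr; have [L HL] := lr.
have hY := lvlperm_Ycan Hn sigma pJ.
have bounds (s : {ffun 'I_N -> {perm 'I_n}}) : adm lam s ->
    [/\ SH J (Qof B (Ycan sigma J) s) (Dm J) + SV J (Qof B (Ycan sigma J) s) (Dm J)
          <= S0 J (Dm J) + S0 J (Dm J),
        SH J (Qof B (Ycan sigma J) s) (Dp J) + SV J (Qof B (Ycan sigma J) s) (Dp J)
          <= S0 J (Dp J) + S0 J (Dp J) + (Mn J).-1 & 0 < Mn J]%N.
  by move=> hs; apply: (degree_bounds HI pJ) JI; exact: (good_Qof Hn partB hY (Ycan_last _ _) hs).
(* The identity family is admissible, so the bounds apply at least once; positivity makes the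
   natural number [(Mn J).-1] equal to [Mbound lam - 1]. *)
have M0 : (0 < Mn J)%N.
  by case: (bounds [ffun=> 1%g]) => //; apply/admP => k i; rewrite ffunE perm1 eqxx.
have ME : Mbound lam - 1 = (Mn J).-1%:Z by rewrite (Mbound_Mn pJ); lia.
pose C (t : F * ('I_n -> int) * int) := (0 <= phiJ J t.1.2) && (phiJ J t.1.2 <= Mbound lam - 1).
exists [seq t <- L | C t]; split; last by move=> t H _; exact: (In_filter H).
have lL' : laur2 (fun z h => \sum_(t <- [seq t <- L | C t]) t.1.1 * mon t.1.2 z * h ^ t.2).
  by apply/laur2P; exists [seq t <- L | C t].
have lr2 : laur2 r by apply/laur2P.
apply: (laur2_generic_domE lr2 lL') => z h gz; have [hz _ hh _ _] := gz.
rewrite HL // big_filter.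
have -> : \sum_(t <- L) t.1.1 * mon t.1.2 z * h ^ t.2 =
   \sum_(u <- [seq (t.1.1 * mon t.1.2 z * h ^ t.2, phiJ J t.1.2) | t <- L]) u.1.
  by rewrite big_map.
(* [r * Ered * Vred] is the sum of the [UH * UV]. The exponents of [Ered] and [Vred] fill their
   range exactly, so the excess of the numerators bounds those of [r]. *)
rewrite (@laurent_range _ _ (fun q => Ered J (zq J z q) h * Vred J (zq J z q))
  (fun q => \sum_(s : {ffun 'I_N -> {perm 'I_n}} | adm lam s)
     UH J (Qof B (Ycan sigma J) s) (zq J z q) h * UV J (Qof B (Ycan sigma J) s) (zq J z q))
  (S0 J (Dm J) + S0 J (Dm J)) (S0 J (Dp J) + S0 J (Dp J)) (Mn J).-1).
- by rewrite big_map /= -ME.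
- by apply: rngx_mul; [exact: (rngx_Ered J hz gz) | exact: (rngx_Vred J hz gz)].
- apply: rng_sum => s hs; have [b1 b2 _] := bounds s hs.
  by apply: rng_weaken b1 b2 _; apply: rng_mul; [apply: rng_UH | apply: rng_UV].
move=> q hq; have hzq := torus_zq J hz hq.
rewrite -(wt_V Hn lG HG) // Hr // mulrA [_ * Ered _ _ _]mulrC; congr (_ * _ * _).
rewrite HL // big_map; apply: eq_bigr => t _ /=; rewrite mon_zq //; ring.
Qed.
End Small.

(** * Assembling the class from its restrictions *)

Unset Implicit Arguments.

Theorem theorem6p7 (F : numClosedFieldType) (N n : nat) (lam : 'I_N -> nat)
  (Hn : (\sum_(k < N) lam k)%N = n)
  (sigma : 'S_n) (I : {ffun 'I_n -> 'I_N}) (HI : is_part lam I) :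
  exists kappa : ('I_n -> F) -> ('I_n -> F) -> F -> F,
    [/\ KT lam kappa /\
        (forall J, is_part lam J -> forall z h, generic z h ->
           restr lam kappa J z h = Wt lam sigma I J z h),
        (forall q, KT lam q ->
           (forall J, is_part lam J -> forall z h, generic z h ->
              restr lam q J z h = Wt lam sigma I J z h) ->
           in_ideal lam (fun g z h => kappa g z h - q g z h)),
        (forall J, is_part lam J -> exists q, laurent_zh q /\
           forall z h, torus z -> h != 0 ->
             restr lam kappa J z h = q z h * evert sigma J z h),
        (forall z h, torus z -> h != 0 ->
           restr lam kappa I z h = Pf sigma I z h * ef sigma I z h) &
        (forall J, is_part lam J -> J != I -> small lam J (restr lam kappa J))].
Proof.
have [G lG HG] := SU_laurent F Hn sigma HI.
have HG' : forall (J : {ffun 'I_n -> 'I_N}) Y z h, lvlperm lam J Y -> torus z -> h != 0 ->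
  injective z -> G (xY Y z h) = SU lam (fun x => I (sigma x)) J Y z h by move=> J; exact: HG.
(* Stated for every function [J], with a dummy outside the fixed points, so that all quotients are
   chosen at once. *)
have ex (J : {ffun 'I_n -> 'I_N}) : exists q : ('I_n -> F) -> F -> F, is_part lam J ->
    laur2 q /\ forall z h, torus z -> h != 0 ->
    wt sigma G J z h = Ered J z h * evert sigma J z h * q z h.
  have [/eqfunP pJ|npJ] := boolP [forall k, #|[pred x | J x == k]| == lam k].
    by have [q lq Hq] := wt_div Hn HI lG HG' pJ; exists q.
  by exists (fun _ _ => 0) => pJ; case/negP: npJ; apply/eqfunP.
have [q Hq] := fin_all_exists ex.
(* Keeping [evert] as a factor of the interpolated family makes (I) immediate. *)
pose r J z h : F := q J z h * evert sigma J z h.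
have lr J : is_part lam J -> laur2 (r J).
  by move=> /Hq[lq _]; apply: laur_mul => //; exact: laur2_evert.
have Hr J z h : is_part lam J -> torus z -> h != 0 -> wt sigma G J z h = Ered J z h * r J z h.
  by move=> /Hq[_ E] hz hh; rewrite E // /r; ring.
have [k kk Hk] : exists2 k, KT lam k & forall J, is_part lam J -> forall z h, torus z -> h != 0 ->
    restr lam k J z h = r J z h.
  apply: class_of_restrictions => // J a b z h pJ hz hh E.
  have pJ' := part_tperm a b pJ.
  by apply: (gkm Hn HI lG HG' pJ (lr _ pJ) (lr _ pJ') _ _ hz hh E) => y c hy hc; exact: Hr.
have Hgen J : is_part lam J -> forall z h, generic z h -> restr lam k J z h = Wt lam sigma I J z h.
  move=> pJ z h gz; have [hz zi hh _ _] := gz; have hY := lvlperm_Ycan Hn sigma pJ.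
  rewrite Hk // (Wt_SU Hn HI pJ hY (Ycan_last _ _) gz) -(HG J) //.
  by rewrite -/(wt sigma G J z h) Hr // mulrC mulKf // Ered_neq0.
exists k; split; first by split.
- move=> p kp Hp; apply: (restr_eq0_in_ideal Hn) => [|J pJ z h gz].
    have [/laur3P lk ik] := kk; have [/laur3P lp ip] := kp; split.
      by apply/laur3P; exact: laur_sub.
    by move=> s hs g z h hgt hz hh; rewrite ik // ip.
  by rewrite -[LHS]/(restr lam k J z h - restr lam p J z h) Hgen // Hp // subrr.
- move=> J pJ; exists (q J); split; first by apply/laur2P; case: (Hq J pJ).
  by move=> z h hz hh; rewrite Hk.
- apply: (@laur2_generic_domE F n _ (fun z h => Pf sigma I z h * ef sigma I z h)).
  + exact: laur2_restr.
  + rewrite /laur2 /Pf /ef /evert; laur_tac.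
  move=> z h gz; have [hz zi hh _ _] := gz; rewrite Hk //.
  apply: (mulfI (Ered_neq0 I gz)); rewrite -Hr // -(SU_diag Hn sigma HI) //.
  have hY : lvlperm lam I (fun k => (bet (fun x => I (sigma x)) k * sigma)%g).
    by move=> l hl a; rewrite permM (bet_mem (part_comp sigma HI)).
  rewrite (wtE Hn HI lG HG' HI hY) //; first exact: HG'.
  by rewrite bet_last mul1g.
move=> J pJ JI; have [L [HL HC]] := small_of_wt Hn HI lG HG' pJ JI (lr J pJ) (fun z h => Hr J z h pJ).
by exists L; split=> // z h hz hh; rewrite Hk // HL.
Qed.
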